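(* Let $S\subset[m]\times[n]$ be a zero pattern which is permutationally equivalent to the row zero pattern $\{(1,1),\ldots,(1,|S|)\}$. Then $$\mathrm{EDdegree}(\mathcal{L}_1^S)=\min\{m,n-|S|\}+\min\{m-1,n\}.$$ Similarly, let $S\subset[m]\times[n]$ be a zero pattern which is permutationally equivalent to the column zero pattern $\{(1,1),\ldots,(|S|,1)\}$. Then $$\mathrm{EDdegree}(\mathcal{L}_1^S)=\min\{m,n-1\}+\min\{m-|S|,n\}.$$
   Context: Notation: $[m]=\{1,\dots,m\}$. A zero pattern is a subset $S\subset[m]\times[n]$. Its mask matrix $M^S$ is the $m\times n$ matrix with entries in $\{0,1\}$ whose $(i,j)$-th entry is $\chi_S(i,j)$, the characteristic function of $S$. Two zero patterns $S_1,S_2$ are permutationally equivalent if there exist permutation matrices $P_1,P_2$ with $M^{S_1}=P_1M^{S_2}P_2$. $\mathcal{L}^S=\{X=(x_{ij})\in\mathbb{C}^{m\times n}\mid x_{ij}=0\ \forall (i,j)\in S\}$, $\mathcal{X}_1$ is the variety of complex $m\times n$ matrices of rank at most one, and $\mathcal{L}_1^S=\mathcal{X}_1\cap\mathcal{L}^S$. ED degree: for $U=(u_{ij})\in\mathbb{C}^{m\times n}$ let $d_U(X)=\sum_{i,j}(x_{ij}-u_{ij})^2$. A critical point of $d_U$ on an algebraic variety $\mathcal{X}\subset\mathbb{C}^{m\times n}$ is a smooth point $X\in\mathcal{X}$ such that $U-X$ is orthogonal to the tangent space $T_X\mathcal{X}$ with respect to the complex bilinear form $\langle A,B\rangle_F=\mathrm{trace}(AB^T)$.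 $\mathrm{EDdegree}(\mathcal{X})$ is the number of critical points of $d_U$ on $\mathcal{X}$ for generic $U\in\mathbb{C}^{m\times n}$ (i.e. $U$ outside some proper Zariski closed set).
   Formalization: S is assumed nonempty and different from all of [m]×[n]: for S=[m]×[n] (m=1 in the row case, n=1 in the column case) the variety is {0} with EDdegree 1 while the formula gives 0, and for empty S the formula fails once m≥2 (row) or n≥2 (column). *)

(* Defs.v *)
From HB Require Import structures.
From mathcomp Require Import all_boot all_order all_algebra.
From mathcomp Require Import classical_sets reals.
From mathcomp Require Import complex.
From mathcomp Require Import mpoly.

Set Implicit Arguments.
Unset Strict Implicit.
Unset Printing Implicit Defensive.

Import GRing.Theory.
Local Open Scope classical_set_scope.
Local Open Scope ring_scope.

(* Matrix space as affine m*n-space: the k-th variable is the k-th coordinate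
   of [mxvec], that is, 'X_(mxvec_index i j) is the entry (i, j). *)
Definition mxeval (F : fieldType) (m n : nat) (p : {mpoly F[m * n]})
    (X : 'M[F]_(m, n)) : F :=
  p.@[fun k => mxvec X 0 k].

Definition zariski_closed (F : fieldType) (m n : nat)
    (Z : set 'M[F]_(m, n)) : Prop :=
  exists P : set {mpoly F[m * n]},
    forall X, Z X <-> (forall p, P p -> mxeval p X = 0).

Definition vanishing_ideal (F : fieldType) (m n : nat)
    (V : set 'M[F]_(m, n)) : set {mpoly F[m * n]} :=
  fun p => forall X, V X -> mxeval p X = 0.

Definition tangent_space (F : fieldType) (m n : nat)
    (V : set 'M[F]_(m, n)) (X : 'M[F]_(m, n)) : set 'M[F]_(m, n) :=
  fun A => forall p, vanishing_ideal V p ->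
    \sum_(k < m * n) mxeval p^`M(k) X * mxvec A 0 k = 0.

Definition irreducible_closed (F : fieldType) (m n : nat)
    (Z : set 'M[F]_(m, n)) : Prop :=
  [/\ zariski_closed Z, Z !=set0 &
      forall Z1 Z2 : set 'M[F]_(m, n),
        zariski_closed Z1 -> zariski_closed Z2 ->
        Z `<=` Z1 `|` Z2 -> Z `<=` Z1 \/ Z `<=` Z2].

Definition local_chain (F : fieldType) (m n : nat)
    (V : set 'M[F]_(m, n)) (X : 'M[F]_(m, n)) (e : nat) : Prop :=
  exists Z : nat -> set 'M[F]_(m, n),
    (forall i, (i <= e)%N -> [/\ irreducible_closed (Z i), Z i X & Z i `<=` V])
    /\ (forall i, (i < e)%N -> Z i `<` Z i.+1).

(* Krull dimension of the local ring of V at X; equivalently the largest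
   dimension of an irreducible component of V passing through X. *)
Definition local_dim (F : fieldType) (m n : nat)
    (V : set 'M[F]_(m, n)) (X : 'M[F]_(m, n)) (d : nat) : Prop :=
  local_chain V X d /\ (forall e, local_chain V X e -> (e <= d)%N).

(* V may be reducible with components of different dimensions, so the
   dimension of the tangent space is compared with the local one. *)
Definition smooth_point (F : fieldType) (m n : nat)
    (V : set 'M[F]_(m, n)) (X : 'M[F]_(m, n)) : Prop :=
  V X /\ exists T : {vspace 'M[F]_(m, n)},
    (forall A, A \in T <-> tangent_space V X A) /\ local_dim V X (\dim T).

Definition ED_critical (F : fieldType) (m n : nat)
    (V : set 'M[F]_(m, n)) (U X : 'M[F]_(m, n)) : Prop :=
  smooth_point V X /\
  (forall A, tangent_space V X A -> \tr ((U - X) *m A^T) = 0).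

(* "EDdegree(V) = d"; over an infinite field such a d is unique, since matrix
   space is not the union of two proper Zariski closed subsets. *)
Definition EDdegree_is (F : fieldType) (m n : nat)
    (V : set 'M[F]_(m, n)) (d : nat) : Prop :=
  exists Z : set 'M[F]_(m, n),
    [/\ zariski_closed Z, (exists U, ~ Z U) &
        forall U, ~ Z U ->
          exists s : seq 'M[F]_(m, n),
            [/\ uniq s, size s = d & forall X, X \in s <-> ED_critical V U X]].

Definition mask_mx (m n : nat) (S : {set 'I_m * 'I_n}) : 'M[int]_(m, n) :=
  \matrix_(i, j) ((i, j) \in S)%:R.

Definition perm_equivalent (m n : nat) (S1 S2 : {set 'I_m * 'I_n}) : Prop :=
  exists (P1 : 'M[int]_m) (P2 : 'M[int]_n),
    [/\ is_perm_mx P1, is_perm_mx P2 & mask_mx S1 = P1 *m mask_mx S2 *m P2].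

(* Indices are 0-based. For k > n (resp. k > m) the set below has fewer than k
   elements, so no S with #|S| = k is permutationally equivalent to it. *)
Definition row_zero_pattern (m n k : nat) : {set 'I_m * 'I_n} :=
  finset (fun p : 'I_m * 'I_n => (p.1 == 0%N :> nat) && (p.2 < k)%N).

Definition column_zero_pattern (m n k : nat) : {set 'I_m * 'I_n} :=
  finset (fun p : 'I_m * 'I_n => (p.1 < k)%N && (p.2 == 0%N :> nat)).

Definition sparse_mx (F : fieldType) (m n : nat) (S : {set 'I_m * 'I_n}) :
    set 'M[F]_(m, n) :=
  fun X => forall i j, (i, j) \in S -> X i j = 0.

Definition rank_le1 (F : fieldType) (m n : nat) : set 'M[F]_(m, n) :=
  fun X => (\rank X <= 1)%N.

Definition sparse_rank_le1 (F : fieldType) (m n : nat)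
    (S : {set 'I_m * 'I_n}) : set 'M[F]_(m, n) :=
  @rank_le1 F m n `&` @sparse_mx F m n S.

(* Main.v *)
Require Import Defs.
From HB Require Import structures.
From mathcomp Require Import all_boot all_order all_algebra.
From mathcomp Require Import fingroup perm separable.
From mathcomp Require Import boolp classical_sets reals.
From mathcomp Require Import complex.
From mathcomp Require Import mpoly ring zify.

(** A pattern equivalent to a row or column pattern is a block I0 x J0, and a
    matrix of rank at most one vanishes on I0 x J0 if and only if it vanishes
    on all rows in I0 or on all columns in J0
    ([block_decomposition]). So the variety is a union of two components
    [supp_rank1 P Q]: the matrices of rank at most one supported on P x Q, with
    either P the complement of I0 and Q everything, or P everything and Q the
    complement of J0. The theorem says that each component contributes its own
    ED degree min(|P|, |Q|), as in the Eckart-Young theorem.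

    One component. A nonzero rank-one X is critical on the p x q matrices of
    rank at most one exactly when (W - X) X^T = 0 and X^T (W - X) = 0. Writing
    X = x z^T, this says that z is an eigenvector of G = W^T W and that
    X = W z z^T / (z^T z). If q <= p and G has simple spectrum, the symmetry of
    G forces z^T z <> 0 for all eigenvectors, and there are exactly q critical
    points ([critical_count]); the case p < q follows by transposition. Simple
    spectrum is expressed by the invertibility of chi'(G), chi being the
    characteristic polynomial. The invertibility of two Krylov matrices
    ensures that a prescribed entry of every critical point is nonzero.
    All these conditions are nonvanishing conditions on polynomials in the
    entries of W, and a diagonal and a bidiagonal W show that they can be met.

    Gluing. The prescribed entry is chosen in a column of J0 for the first
    component and in a row of I0 for the second, so that no critical point of
    one component lies on the other. At such a point X the variety is smooth:
    the 2 x 2 minors and the zero entries cut out a space of tangent vectors of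
    dimension d = |P| + |Q| - 1, all of which are tangent to the component,
    and d is the local dimension ([smooth_component]). Conversely the tangent
    space of the variety at any point contains the directions of each component
    through it, so a critical point of the variety is 0 or critical on one
    component; and 0 is not critical as soon as U has a nonzero entry off the
    pattern.

    Local dimension. A chain of length d is obtained by freeing, one at a time,
    the entries of a pivot row and a pivot column of X ([slice_chain]). For
    the upper bound, if Z_0 < ... < Z_e are irreducible and g_i vanishes on
    Z_i but not on Z_(i+1), the monomials in the g_i with exponents below N
    are N^e linearly independent functions on Z_e, of degree O(N)
    ([chain_lin_indep]). On a component, a function of degree at most K times
    the K-th power of a pivot entry is a combination of the (2K+1)^d
    monomials with exponents at most 2K in the entries of the pivot row and
    column ([cross_span]). Comparing for large N gives e <= d. *)

Set Implicit Arguments.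
Unset Strict Implicit.
Unset Printing Implicit Defensive.

Import Order.TTheory GRing.Theory Num.Theory.
Local Open Scope ring_scope.

(** * Polynomial functions and generic properties *)

(** Working with functions rather than with elements of [{mpoly F[m * n]}] makes
    composition and determinants immediate. *)
Definition polyfun (F : fieldType) (m n : nat) (f : 'M[F]_(m, n) -> F) :=
  exists p : {mpoly F[m * n]}, forall X, mxeval p X = f X.

(** Containing a nonempty principal open set, rather than any nonempty open set,
    is what one polynomial condition provides, and it is stable under
    conjunction. *)
Definition generic (F : fieldType) (m n : nat) (P : 'M[F]_(m, n) -> Prop) :=
  exists f : 'M[F]_(m, n) -> F,
    [/\ polyfun f, exists U, f U != 0 & forall U, f U != 0 -> P U].

Section PolyFun.
Variables (F : fieldType) (m n : nat).
Implicit Types f g : 'M[F]_(m, n) -> F.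

Lemma polyfun_ext f g : f =1 g -> polyfun f -> polyfun g.
Proof. by move=> e [p hp]; exists p => X; rewrite hp e. Qed.

Lemma polyfun_cst c : polyfun (fun _ : 'M[F]_(m, n) => c).
Proof. by exists c%:MP => X; rewrite /mxeval mevalC. Qed.

Lemma polyfun_entry i j : polyfun (fun X : 'M[F]_(m, n) => X i j).
Proof. by exists 'X_(mxvec_index i j) => X; rewrite /mxeval mevalXU mxvecE. Qed.

Lemma polyfunD f g : polyfun f -> polyfun g -> polyfun (fun X => f X + g X).
Proof. by move=> [p hp] [q hq]; exists (p + q) => X; rewrite /mxeval mevalD -hp -hq. Qed.

Lemma polyfunM f g : polyfun f -> polyfun g -> polyfun (fun X => f X * g X).
Proof. by move=> [p hp] [q hq]; exists (p * q) => X; rewrite /mxeval mevalM -hp -hq. Qed.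

Lemma polyfunN f : polyfun f -> polyfun (fun X => - f X).
Proof. by move=> [p hp]; exists (- p) => X; rewrite /mxeval mevalN -hp. Qed.

Lemma polyfunB f g : polyfun f -> polyfun g -> polyfun (fun X => f X - g X).
Proof. by move=> hf hg; apply: polyfunD => //; apply: polyfunN. Qed.

Lemma polyfun_sum (I : Type) (r : seq I) (P : pred I) (f : I -> 'M[F]_(m, n) -> F) :
  (forall i, polyfun (f i)) -> polyfun (fun X => \sum_(i <- r | P i) f i X).
Proof.
move=> hf; elim: r => [|i r IH].
  by apply: (polyfun_ext _ (polyfun_cst 0)) => X; rewrite big_nil.
have [Pi|Pi] := boolP (P i).
  by apply: (polyfun_ext _ (polyfunD (hf i) IH)) => X; rewrite big_cons Pi.
by apply: (polyfun_ext _ IH) => X; rewrite big_cons (negPf Pi).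
Qed.

Lemma polyfun_prod (I : Type) (r : seq I) (P : pred I) (f : I -> 'M[F]_(m, n) -> F) :
  (forall i, polyfun (f i)) -> polyfun (fun X => \prod_(i <- r | P i) f i X).
Proof.
move=> hf; elim: r => [|i r IH].
  by apply: (polyfun_ext _ (polyfun_cst 1)) => X; rewrite big_nil.
have [Pi|Pi] := boolP (P i).
  by apply: (polyfun_ext _ (polyfunM (hf i) IH)) => X; rewrite big_cons Pi.
by apply: (polyfun_ext _ IH) => X; rewrite big_cons (negPf Pi).
Qed.

Lemma polyfunX f k : polyfun f -> polyfun (fun X => f X ^+ k).
Proof.
move=> hf; elim: k => [|k IH]; first exact: (polyfun_cst 1).
by apply: (polyfun_ext _ (polyfunM hf IH)) => X; rewrite exprS.
Qed.

Lemma polyfun_det k (f : 'M[F]_(m, n) -> 'M[F]_k) :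
  (forall i j, polyfun (fun X => f X i j)) -> polyfun (fun X => \det (f X)).
Proof.
move=> hf; apply: polyfun_sum => s; apply: polyfunM; first exact: polyfun_cst.
exact: polyfun_prod.
Qed.

Lemma polyfun_mulmx k l r (f : 'M[F]_(m, n) -> 'M[F]_(k, l))
    (g : 'M[F]_(m, n) -> 'M[F]_(l, r)) :
  (forall i j, polyfun (fun X => f X i j)) ->
  (forall i j, polyfun (fun X => g X i j)) ->
  forall i j, polyfun (fun X => (f X *m g X) i j).
Proof.
move=> hf hg i j.
apply: (@polyfun_ext (fun X => \sum_k f X i k * g X k j)).
  by move=> X; rewrite mxE.
by apply: polyfun_sum => a; apply: polyfunM.
Qed.

Lemma polyfun_comp m' n' (h : 'M[F]_(m', n') -> F)
    (phi : 'M[F]_(m, n) -> 'M[F]_(m', n')) :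
  polyfun h -> (forall i j, polyfun (fun X => phi X i j)) ->
  polyfun (fun X => h (phi X)).
Proof.
move=> [p hp] hphi.
apply: (@polyfun_ext (fun X => \sum_(a <- msupp p)
          p@_a * \prod_k (mxvec (phi X) 0 k) ^+ a k)).
  by move=> X; rewrite -hp /mxeval mevalE.
apply: polyfun_sum => a; apply: polyfunM; first exact: polyfun_cst.
apply: polyfun_prod => k; apply: polyfunX.
case/mxvec_indexP: k => i j.
by apply: (polyfun_ext _ (hphi i j)) => X; rewrite mxvecE.
Qed.

Definition curve_at (C : 'M[{poly F}]_(m, n)) (t : F) : 'M[F]_(m, n) :=
  \matrix_(i, j) (C i j).[t].

Lemma polyfun_curve f (C : 'M[{poly F}]_(m, n)) :
  polyfun f -> exists q : {poly F}, forall t, f (curve_at C t) = q.[t].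
Proof.
move=> [p hp].
exists (\sum_(a <- msupp p) p@_a *: \prod_k (mxvec C 0 k) ^+ a k) => t.
rewrite -hp /mxeval mevalE horner_sum; apply: eq_bigr => a _.
rewrite hornerZ horner_prod; congr (_ * _); apply: eq_bigr => k _.
by case/mxvec_indexP: k => i j; rewrite horner_exp !mxvecE mxE.
Qed.

(** The chain rule along a line. As a univariate polynomial [q] with the given
    values is determined only over an infinite field, both properties of [q]
    are proved together, by induction on [p]. *)
Lemma mxeval_line_deriv (p : {mpoly F[m * n]}) (X A : 'M[F]_(m, n)) :
  exists q : {poly F}, (forall t, mxeval p (X + t *: A) = q.[t]) /\
    q^`().[0] = \sum_(k < m * n) mxeval p^`M(k) X * mxvec A 0 k.
Proof.
pose good (p : {mpoly F[m * n]}) := exists q : {poly F},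
   (forall t, mxeval p (X + t *: A) = q.[t]) /\
    q^`().[0] = \sum_(k < m * n) mxeval p^`M(k) X * mxvec A 0 k.
have goodC c : good c%:MP.
  exists c%:P; split=> [t|]; first by rewrite /mxeval mevalC hornerC.
  rewrite derivC horner0 big1 // => k _.
  by rewrite mderivC /mxeval meval0 mul0r.
have goodD p1 p2 : good p1 -> good p2 -> good (p1 + p2).
  move=> [q1 [h1 d1]] [q2 [h2 d2]]; exists (q1 + q2); split=> [t|].
    by rewrite /mxeval mevalD -/(mxeval p1 _) -/(mxeval p2 _) h1 h2 hornerD.
  rewrite derivD hornerD d1 d2 -big_split; apply: eq_bigr => k _ /=.
  by rewrite mderivD /mxeval mevalD mulrDl.
have goodM p1 p2 : good p1 -> good p2 -> good (p1 * p2).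
  move=> [q1 [h1 d1]] [q2 [h2 d2]]; exists (q1 * q2); split=> [t|].
    by rewrite /mxeval mevalM -/(mxeval p1 _) -/(mxeval p2 _) h1 h2 hornerM.
  rewrite derivM hornerD !hornerM d1 d2 -h1 -h2 scale0r addr0 mulr_suml mulr_sumr.
  rewrite -big_split; apply: eq_bigr => k _ /=.
  rewrite mderivM /mxeval mevalD !mevalM -/(mxeval _ _) mulrDl -!mulrA.
  by congr (_ + _); congr (_ * _); apply: mulrC.
have goodX k : good 'X_k.
  exists ((mxvec X 0 k)%:P + mxvec A 0 k *: 'X); split=> [t|].
    rewrite /mxeval mevalXU linearD linearZ /= !hornerE.
    by rewrite !mxE mulrC.
  rewrite derivD derivC add0r derivZ derivX hornerZ hornerC mulr1.
  rewrite (bigD1 k) //= mderivX mnm1E eqxx scale1r.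
  have -> : (U_(k) - U_(k) = 0 :> 'X_{1.. m * n})%MM.
    by apply/mnmP => i; rewrite mnmBE mnm0E subnn.
  rewrite mpolyX0 /mxeval meval1 mul1r big1 ?addr0 // => l lk.
  by rewrite mderivX mnm1E eq_sym (negPf lk) scale0r meval0 mul0r.
suff goodA p' : good p' by exact: goodA.
elim/mpolyind: p' => [|c a p' _ _ IH]; first by rewrite -mpolyC0.
apply: goodD IH; rewrite -mul_mpolyC; apply: (goodM); first exact: goodC.
rewrite mpolyXE_id; apply: (big_ind good) => //; first by rewrite -mpolyC1.
move=> i _; elim: (a i) => [|k IH]; first by rewrite expr0 -mpolyC1.
by rewrite exprS; apply: goodM.
Qed.

End PolyFun.

Section InfiniteField.
Variable F : numFieldType.

Lemma poly_nonroot (q : {poly F}) : q != 0 -> exists t, q.[t] != 0.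
Proof.
move=> q0; pose s := [seq i%:R : F | i <- iota 0 (size q)].
have us : uniq s by rewrite map_inj_uniq ?iota_uniq //; apply: (mulrIn (oner_neq0 F)).
case: (boolP (all (root q) s)) => [/(max_poly_roots q0)/(_ us)|].
  by rewrite size_map size_iota ltnn.
by case/allPn => t _ h; exists t.
Qed.

Variables (m n : nat).

(** The two witnesses are joined by a line; on it the two polynomials restrict to
    nonzero univariate ones, whose product has a nonroot. *)
Lemma generic_and (P Q : 'M[F]_(m, n) -> Prop) :
  generic P -> generic Q -> generic (fun U => P U /\ Q U).
Proof.
move=> [f [pf [U fU] fP]] [g [pg [V gV] gQ]].
exists (fun X => f X * g X); split; first exact: polyfunM; last first.
  by move=> X; rewrite mulf_eq0 negb_or => /andP[/fP ? /gQ].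
pose C : 'M[{poly F}]_(m, n) := \matrix_(i, j) ((U i j)%:P + (V i j - U i j) *: 'X).
have C0 : curve_at C 0 = U by apply/matrixP => i j; rewrite !mxE !hornerE.
have C1 : curve_at C 1 = V.
  by apply/matrixP => i j; rewrite !mxE !hornerE /=; ring.
have [q hq] := polyfun_curve C pf; have [r hr] := polyfun_curve C pg.
have q0 : q != 0 by apply: contraNneq fU => e; rewrite -C0 hq e horner0.
have r0 : r != 0 by apply: contraNneq gV => e; rewrite -C1 hr e horner0.
have [t] := poly_nonroot (mulf_neq0 q0 r0).
by rewrite hornerM -hq -hr => h; exists (curve_at C t).
Qed.

Lemma generic_weaken (P Q : 'M[F]_(m, n) -> Prop) :
  (forall U, P U -> Q U) -> generic P -> generic Q.
Proof. by move=> h [f [pf ne fP]]; exists f; split => // U /fP /h. Qed.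

Lemma generic_comp p q (P : 'M[F]_(p, q) -> Prop) (phi : 'M[F]_(m, n) -> 'M[F]_(p, q)) :
  (forall i j, polyfun (fun U => phi U i j)) ->
  (forall W, exists U, phi U = W) ->
  generic P -> generic (fun U => P (phi U)).
Proof.
move=> pphi sphi [f [pf [W fW] fP]]; exists (fun U => f (phi U)).
split; [exact: polyfun_comp | | by move=> U /fP].
by have [U eU] := sphi W; exists U; rewrite eU.
Qed.

End InfiniteField.

(** * Irreducible closed sets and chains of them *)

Section Zariski.
Local Open Scope classical_set_scope.
Variables (F : numFieldType) (m n : nat).
Implicit Types (Z W : set 'M[F]_(m, n)) (X : 'M[F]_(m, n)).

Lemma zariski_closed_polyfun (I : Type) (f : I -> 'M[F]_(m, n) -> F) :
  (forall i, polyfun (f i)) -> zariski_closed (fun X => forall i, f i X = 0).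
Proof.
move=> hf; exists (fun p => exists i, forall X, mxeval p X = f i X) => X.
split=> [h p [i ->]|h i]; first exact: h.
by have [p hp] := hf i; rewrite -hp; apply: h; exists i.
Qed.

Lemma zariski_closed_sep Z X : zariski_closed Z -> ~ Z X ->
  exists p : {mpoly F[m * n]}, (forall Y, Z Y -> mxeval p Y = 0) /\ mxeval p X != 0.
Proof.
move=> [P hP] nZX; apply: contrapT => h; apply: nZX; apply/hP => p Pp.
apply: contrapT => /eqP npX; apply: h; exists p; split=> // Y /hP; exact.
Qed.

Definition zclosure W : set 'M[F]_(m, n) :=
  fun X => forall p, vanishing_ideal W p -> mxeval p X = 0.

Lemma sub_zclosure W : W `<=` zclosure W.
Proof. by move=> X WX p; apply. Qed.

Lemma zclosure_sub W Z : zariski_closed Z -> W `<=` Z -> zclosure W `<=` Z.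
Proof. by move=> [P hP] WZ X h; apply/hP => p Pp; apply: h => Y /WZ /hP; apply. Qed.

Lemma zclosure_closed W : zariski_closed (zclosure W).
Proof. by exists (vanishing_ideal W) => X; split => // h p; apply: h. Qed.

(** If two closed sets cover [W] and neither contains it, a curve joining a point
    outside the first to a point outside the second would give two nonzero
    univariate polynomials with product zero everywhere. *)
Lemma irreducible_zclosure W :
  W !=set0 ->
  (forall M1 M2, W M1 -> W M2 -> exists C : 'M[{poly F}]_(m, n),
     [/\ curve_at C 0 = M1, curve_at C 1 = M2 & forall t, W (curve_at C t)]) ->
  irreducible_closed (zclosure W).
Proof.
move=> [X0 WX0] curves; split; first exact: zclosure_closed.
  by exists X0; apply: sub_zclosure.
have sep Z : zariski_closed Z -> ~ (zclosure W `<=` Z) ->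
    exists p M, [/\ forall Y, Z Y -> mxeval p Y = 0, W M & mxeval p M != 0].
  move=> cZ nWZ; have [M WM nZM] : exists2 M, W M & ~ Z M.
    by apply: contrapT => h; apply: nWZ; apply: zclosure_sub => // M WM;
       apply: contrapT => nZM; apply: h; exists M.
  by have [p [pZ pM]] := zariski_closed_sep cZ nZM; exists p, M.
move=> Z1 Z2 cZ1 cZ2 W12; apply: contrapT => /not_orP[/(sep _ cZ1) h1 /(sep _ cZ2) h2].
have {h1} [p1 [M1 [p1Z WM1 p1M]]] := h1.
have {h2} [p2 [M2 [p2Z WM2 p2M]]] := h2.
have [C [C0 C1 WC]] := curves _ _ WM1 WM2.
have [q1 hq1] := polyfun_curve C (ex_intro _ p1 (fun X => erefl (mxeval p1 X))).
have [q2 hq2] := polyfun_curve C (ex_intro _ p2 (fun X => erefl (mxeval p2 X))).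
have q10 : q1 != 0 by apply: contraNneq p1M => e; rewrite -C0 hq1 e horner0.
have q20 : q2 != 0 by apply: contraNneq p2M => e; rewrite -C1 hq2 e horner0.
have [t] := poly_nonroot (mulf_neq0 q10 q20).
rewrite hornerM -hq1 -hq2 mulf_eq0 negb_or => /andP[n1 n2].
by case: (W12 _ (sub_zclosure (WC t))) => [/p1Z|/p2Z] e; rewrite e eqxx in n1 n2.
Qed.

(** Irreducibility as used below: the coordinate ring is a domain. *)
Lemma irreducible_mul Z (f g : 'M[F]_(m, n) -> F) :
  irreducible_closed Z -> polyfun f -> polyfun g ->
  (forall X, Z X -> f X * g X = 0) ->
  forall X, Z X -> f X != 0 -> forall Y, Z Y -> g Y = 0.
Proof.
move=> [_ _ irr] pf pg fg X ZX fX.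
have cf := @zariski_closed_polyfun unit (fun _ => f) (fun _ => pf).
have cg := @zariski_closed_polyfun unit (fun _ => g) (fun _ => pg).
have [|sf|sg] := irr _ _ cf cg.
- by move=> Y /fg /eqP; rewrite mulf_eq0 => /orP[]/eqP; [left|right].
- by move/eqP: fX; rewrite (sf X ZX tt).
by move=> Y /sg /(_ tt).
Qed.

Lemma polyfun_mxeval (p : {mpoly F[m * n]}) : polyfun (@mxeval F m n p).
Proof. by exists p. Qed.

Definition lin_indep_on Z (T : finType) (p : T -> {mpoly F[m * n]}) :=
  forall c : T -> F,
    (forall X, Z X -> \sum_t c t * mxeval (p t) X = 0) -> forall t, c t = 0.

(** In a vanishing combination, let k be the smallest exponent of [g] with a
    nonzero coefficient. As [Z'] is irreducible, [g ^+ k] can be divided out;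
    restricting to [Z], where [g] vanishes, only the terms of exponent k
    survive, and these are independent there. *)
Lemma lin_indep_step Z Z' (g : {mpoly F[m * n]}) N (T : finType)
    (p : T -> {mpoly F[m * n]}) X :
  irreducible_closed Z' -> Z `<=` Z' ->
  (forall Y, Z Y -> mxeval g Y = 0) -> Z' X -> mxeval g X != 0 ->
  lin_indep_on Z p ->
  lin_indep_on Z' (fun u : 'I_N * T => g ^+ u.1 * p u.2).
Proof.
move=> irr ZZ' gZ Z'X gX ind c hc.
suff H k : forall i : 'I_N, (i <= k)%N -> forall t, c (i, t) = 0.
  by case=> i t; apply: (H i).
(* R is the combination divided by g ^+ i. *)
have key (i : 'I_N) : (forall j : 'I_N, (j < i)%N -> forall t, c (j, t) = 0) ->
    forall t, c (i, t) = 0.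
  move=> hi; apply: ind => Y ZY.
  pose R M := \sum_(j < N | (i <= j)%N) \sum_t
     c (j, t) * (mxeval g M ^+ (j - i) * mxeval (p t) M).
  have R0 : forall M, Z' M -> R M = 0.
    apply: (@irreducible_mul Z' (fun M => mxeval g M ^+ i) R irr _ _ _ X) => //.
    - exact/polyfunX/polyfun_mxeval.
    - apply: polyfun_sum => j; apply: polyfun_sum => t; apply: polyfunM.
        exact: polyfun_cst.
      apply: polyfunM; last exact: polyfun_mxeval.
      exact/polyfunX/polyfun_mxeval.
    - move=> M Z'M; rewrite -(hc M Z'M) /R mulr_sumr.
      transitivity (\sum_(j < N) \sum_t c (j, t) * mxeval (g ^+ j * p t) M); last first.
        by rewrite pair_bigA; apply: eq_bigr => -[].
      rewrite [RHS](bigID (fun j : 'I_N => (i <= j)%N)) /= addrC [X in _ = X + _]big1.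
        rewrite add0r; apply: eq_bigr => j ij; rewrite mulr_sumr.
        apply: eq_bigr => t _; rewrite /mxeval mevalM rmorphXn /=.
        rewrite mulrCA [X in _ * X = _]mulrA -exprD subnKC //.
      move=> j; rewrite -ltnNge => ji; apply: big1 => t _.
      by rewrite hi // mul0r.
    - by rewrite expf_neq0.
  rewrite -[RHS](R0 Y (ZZ' _ ZY)) /R (bigD1 i) //= [X in _ = _ + X]big1 ?addr0.
    by apply: eq_bigr => t _; rewrite subnn expr0 mul1r.
  move=> j /andP[ij ji]; apply: big1 => t _.
  by rewrite gZ // expr0n subn_eq0 leqNgt ltn_neqAle ij eq_sym ji /= mul0r mulr0.
elim: k => [|k IH] i hik; apply: key => j ji.
  by move: ji; rewrite ltnNge (leq_trans hik).
by apply: IH; rewrite -ltnS (leq_trans ji).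
Qed.

(** [msize] is the total degree plus one, which explains the predecessor. *)
Lemma msizeM_pred (p q : {mpoly F[m * n]}) :
  (msize (p * q) <= (msize p + msize q).-1)%N.
Proof.
have [->|p0] := eqVneq p 0; first by rewrite mul0r msize0.
have [->|q0] := eqVneq q 0; first by rewrite mulr0 msize0.
by rewrite msizeM.
Qed.

(** The growth form of the inequality between the length of a chain and the
    dimension: e steps give N^e independent functions of degree at most D N. *)
Lemma chain_lin_indep (Z : nat -> set 'M[F]_(m, n)) e :
  (forall i, (i <= e)%N -> irreducible_closed (Z i)) ->
  (forall i, (i < e)%N -> Z i `<` Z i.+1) ->
  exists D, forall N, exists (T : finType) (p : T -> {mpoly F[m * n]}),
    [/\ #|T| = (N ^ e)%N, forall t, (msize (p t) <= (D * N).+1)%N &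
        lin_indep_on (Z e) p].
Proof.
elim: e => [|e IH] irr chain.
  exists 0%N => N; exists unit, (fun _ => 1); split; first by rewrite card_unit.
    by move=> _; rewrite msize1.
  move=> c hc []; have [_ [X ZX] _] := irr 0%N (leqnn _).
  have := hc X ZX; rewrite (bigD1 tt) //= big1 ?addr0; last by case.
  by rewrite /mxeval meval1 mulr1.
have [D hD] := IH (fun i hi => irr i (leqW hi)) (fun i hi => chain i (leqW hi)).
have [ss /existsNP[X /not_implyP[ZX nZX]]] := chain e (leqnn _).
have [clo _ _] := irr e (leqnSn _).
have [g [gZ gX]] := zariski_closed_sep clo nZX.
exists (D + msize g)%N => N; have [T [p [cT sp ind]]] := hD N.
exists ('I_N * T)%type, (fun u : 'I_N * T => g ^+ u.1 * p u.2); split.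
- by rewrite card_prod card_ord cT expnS.
- case=> k t /=; apply: leq_trans (msizeM_pred _ _) _.
  have hk : (msize (g ^+ k) <= (msize g * k).+1)%N.
    elim: (k : nat) => [|l IHl]; first by rewrite expr0 msize1.
    rewrite exprS; apply: leq_trans (msizeM_pred _ _) _.
    by move: IHl; case: (msize g) => [|a]; case: (msize _) => [|b]; nia.
  have := sp t; have := ltn_ord k; move: hk; nia.
- exact: (lin_indep_step (irr _ (leqnn _)) ss gZ ZX gX ind).
Qed.
End Zariski.

(** * Rank-one matrices with prescribed support: dimension from above *)

Section RankOne.
Variables (F : fieldType).

Lemma mx_neq0P m n (X : 'M[F]_(m, n)) : X != 0 -> exists i j, X i j != 0.
Proof.
move=> X0; apply: contrapT => h; case/eqP: X0; apply/matrixP => i j; rewrite mxE.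
by apply: contrapT => /eqP hij; apply: h; exists i, j.
Qed.

Lemma minors_factor m n (X : 'M[F]_(m, n)) k l :
  (forall i j, X i j * X k l = X i l * X k j) -> X k l != 0 ->
  X = col l X *m ((X k l)^-1 *: row k X).
Proof.
move=> minors kl; apply/matrixP => i j.
by rewrite !mxE big_ord1 !mxE mulrCA -minors mulrC mulfK.
Qed.

Lemma rank_le1_minors m n (X : 'M[F]_(m, n)) :
  (\rank X <= 1)%N <-> forall i j k l, X i j * X k l = X i l * X k j.
Proof.
split.
  move=> rX i j k l; rewrite -(mulmx_base X).
  move: (col_base X) (row_base X); move: rX.
  case: (\rank X) => [_ a b|[|//] _ a b]; first by rewrite !mxE !big_ord0 mulr0.
  by rewrite !mxE !big_ord1; ring.
move=> minors; case: (eqVneq X 0) => [->|/mx_neq0P[k [l kl]]]; first by rewrite mxrank0.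
rewrite (minors_factor _ kl); first exact: mulmx_max_rank.
by move=> i j; apply: minors.
Qed.

Lemma rank1_factor m n (X : 'M[F]_(m, n)) k l :
  (\rank X <= 1)%N -> X k l != 0 ->
  X = col l X *m ((X k l)^-1 *: row k X).
Proof. by move=> /rank_le1_minors minors; apply: minors_factor => i j. Qed.

End RankOne.

Section Component.
Variables (F : numFieldType) (m n : nat) (P : {set 'I_m}) (Q : {set 'I_n}).

Definition supp_rank1 : set 'M[F]_(m, n) := fun X =>
  (\rank X <= 1)%N /\ forall i j, ~~ ((i \in P) && (j \in Q)) -> X i j = 0.

Lemma zariski_closed_supp_rank1 : zariski_closed supp_rank1.
Proof.
pose f (u : ('I_m * 'I_n * 'I_m * 'I_n) + {ij : 'I_m * 'I_n | ~~ ((ij.1 \in P) && (ij.2 \in Q))})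
   (X : 'M[F]_(m, n)) := match u with
   | inl (i, j, k, l) => X i j * X k l - X i l * X k j
   | inr ij => X (val ij).1 (val ij).2 end.
have pf u : polyfun (f u).
  case: u => [[[[i j] k] l]|[[i j] hij]]; last exact: polyfun_entry.
  by apply: polyfunB; apply: polyfunM; apply: polyfun_entry.
have [A hA] := zariski_closed_polyfun pf; exists A => X; rewrite -hA; split.
  move=> [/rank_le1_minors r s] [[[[i j] k] l]|[[i j] hij]] /=; last exact: s.
  by rewrite r subrr.
move=> h; split.
  apply/rank_le1_minors => i j k l; apply/eqP; rewrite -subr_eq0; apply/eqP.
  exact: (h (inl (i, j, k, l))).
by move=> i j hij; apply: (h (inr (exist _ (i, j) hij))).
Qed.

(** Fix a pivot position [(i1, l)]. Where the pivot entry is nonzero, a matrix of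
    rank at most one is determined by its row [i1] and its column [l], the
    cross, whose |P| + |Q| - 1 positions in the support serve as coordinates. *)
Section Cross.
Variables (i1 : 'I_m) (l : 'I_n).
Hypotheses (i1P : i1 \in P) (lQ : l \in Q).

Definition cross : {set 'I_m * 'I_n} :=
  finset.setX P [set l] :|: finset.setX [set i1] Q.

Lemma card_cross : #|cross| = (#|P| + #|Q|).-1.
Proof.
have := cardsUI (finset.setX P [set l]) (finset.setX [set i1] Q); rewrite -/cross.
rewrite !cardsX !cards1 muln1 mul1n => <-.
have -> : finset.setX P [set l] :&: finset.setX [set i1] Q = [set (i1, l)].
  apply/setP => -[i j]; rewrite !inE /= xpair_eqE.
  by apply/idP/idP => [/andP[/andP[_ ->] /andP[-> _]]|/andP[/eqP-> /eqP->]];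
     rewrite ?i1P ?lQ ?eqxx.
by rewrite cards1 addn1.
Qed.

Lemma in_cross i j : ((i, j) \in cross) =
  [&& i \in P, j \in Q & (i == i1) || (j == l)].
Proof.
rewrite !inE /=; case: (eqVneq i i1) => [->|_]; case: (eqVneq j l) => [->|_] //=;
 by rewrite ?i1P ?lQ ?andbT ?andbF ?orbF.
Qed.

Definition cross_monomial (b : 'I_m * 'I_n -> nat) (X : 'M[F]_(m, n)) :=
  \prod_(k in cross) X k.1 k.2 ^+ b k.

(** The zero alternative accounts for monomials that involve an entry outside
    the support. *)
Definition cross_mono (r : nat) (f : 'M[F]_(m, n) -> F) :=
  (forall X, supp_rank1 X -> f X = 0) \/
  exists b, (forall k, (b k <= r)%N) /\ forall X, supp_rank1 X -> f X = cross_monomial b X.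

Lemma cross_mono_eq r f g :
  (forall X, supp_rank1 X -> f X = g X) -> cross_mono r f -> cross_mono r g.
Proof.
move=> fg [f0|[b [br hb]]]; [left|right; exists b; split]=> // X hX.
  by rewrite -fg // f0.
by rewrite -fg // hb.
Qed.

Lemma cross_mono_leq r s f : (r <= s)%N -> cross_mono r f -> cross_mono s f.
Proof.
move=> rs [f0|[b [br hb]]]; [by left | right; exists b; split=> // k].
exact: leq_trans (br k) rs.
Qed.

Lemma cross_monoM r s f g : cross_mono r f -> cross_mono s g ->
  cross_mono (r + s) (fun X => f X * g X).
Proof.
move=> [f0 _|[b [br hb]]]; first by left => X hX; rewrite f0 ?mul0r.
move=> [g0|[c [cs hc]]]; first by left => X hX; rewrite g0 ?mulr0.
right; exists (fun k => b k + c k)%N; split=> [k|X hX]; first exact: leq_add.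
rewrite hb // hc // -big_split; apply: eq_bigr => k _ /=; by rewrite exprD.
Qed.

Lemma cross_mono1 : cross_mono 0 (fun _ => 1).
Proof.
right; exists (fun=> 0%N); split => // X _; rewrite /cross_monomial big1 //.
Qed.

Lemma cross_monoX r f k : cross_mono r f -> cross_mono (k * r) (fun X => f X ^+ k).
Proof.
move=> hf; elim: k => [|k IH]; first exact: cross_mono1.
rewrite mulSn; apply: cross_mono_eq (cross_monoM hf IH) => X _.
by rewrite exprS.
Qed.

Lemma cross_mono_entry i j : (i, j) \in cross -> cross_mono 1 (fun X => X i j).
Proof.
move=> hij; right; exists (fun k => (k == (i, j)) : nat); split=> [k|X _].
  exact: leq_b1.
rewrite /cross_monomial (bigD1 (i, j)) //= eqxx expr1 big1 ?mulr1 // => k /andP[_ /negPf->].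
by rewrite expr0.
Qed.

(** The vanishing of the minor through the pivot replaces [X i1 l * X i j] by the
    product of the entries [X i l] and [X i1 j] of the cross. *)
Lemma cross_mono_mul_entry i j : cross_mono 2 (fun X => X i1 l * X i j).
Proof.
have [/andP[iP jQ]|nij] := boolP ((i \in P) && (j \in Q)); last first.
  by left => X hX; rewrite (hX.2 i j nij) mulr0.
have h1 : cross_mono 1 (fun X => X i l).
  by apply: cross_mono_entry; rewrite in_cross iP lQ eqxx orbT.
have h2 : cross_mono 1 (fun X => X i1 j).
  by apply: cross_mono_entry; rewrite in_cross i1P jQ eqxx.
apply: cross_mono_eq (cross_monoM h1 h2) => X [/rank_le1_minors r _].
by rewrite r mulrC.
Qed.

Lemma cross_mono_monomial K (a : 'X_{1.. m * n}) : (mdeg a <= K)%N ->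
  cross_mono (2 * K) (fun X => X i1 l ^+ K * \prod_k (mxvec X 0 k) ^+ a k).
Proof.
move=> aK.
have h (r : seq 'I_(m * n)) : cross_mono ((\sum_(k <- r) a k) * 2)
    (fun X => X i1 l ^+ (\sum_(k <- r) a k) * \prod_(k <- r) (mxvec X 0 k) ^+ a k).
  elim: r => [|k r IH].
    by rewrite big_nil; apply: cross_mono_eq cross_mono1 => X _; rewrite !big_nil mulr1.
  have hk : cross_mono (a k * 2) (fun X => (X i1 l * mxvec X 0 k) ^+ a k).
    apply: cross_monoX; case/mxvec_indexP: k => i j.
    by apply: cross_mono_eq (cross_mono_mul_entry i j) => X _; rewrite mxvecE.
  rewrite big_cons mulnDl; apply: cross_mono_eq (cross_monoM hk IH) => X _.
  by rewrite big_cons exprD exprMn; ring.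
(* The powers of the pivot left over once each factor has received one. *)
have {h}hall := h (index_enum _); rewrite -mdegE in hall.
have hl : cross_mono (K - mdeg a) (fun X => X i1 l ^+ (K - mdeg a)).
  rewrite -[X in cross_mono X]muln1; apply: cross_monoX; apply: cross_mono_entry.
  by rewrite in_cross i1P lQ !eqxx.
apply: (@cross_mono_leq (K - mdeg a + mdeg a * 2)); first by move: aK; lia.
by apply: cross_mono_eq (cross_monoM hl hall) => X _; rewrite mulrA -exprD subnK.
Qed.

Local Notation cross_exp r := {ffun {k | k \in cross} -> 'I_r.+1}.

Lemma cross_mono_index r f : cross_mono r f ->
  exists a : cross_exp r -> F, forall X, supp_rank1 X ->
    f X = \sum_b a b * \prod_k X (val k).1 (val k).2 ^+ b k.
Proof.
case=> [f0|[b [br hb]]].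
  by exists (fun=> 0) => X hX; rewrite f0 // big1 // => b _; rewrite mul0r.
pose b' : cross_exp r := [ffun k => inord (b (val k))].
exists (fun c => (c == b')%:R) => X hX.
rewrite (bigD1 b') //= eqxx mul1r [Y in _ = _ + Y]big1 ?addr0; last first.
  by move=> c /negPf ->; rewrite mul0r.
rewrite hb // /cross_monomial big_sub; apply: eq_bigr => k _.
by rewrite ffunE inordK // ltnS.
Qed.

Lemma cross_span K (p : {mpoly F[m * n]}) : (msize p <= K.+1)%N ->
  exists a : cross_exp (2 * K) -> F, forall X, supp_rank1 X ->
    X i1 l ^+ K * mxeval p X = \sum_b a b * \prod_k X (val k).1 (val k).2 ^+ b k.
Proof.
move=> pK.
have /choice[a ha] : forall e : 'X_{1.. m * n}, exists a : cross_exp (2 * K) -> F,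
    e \in msupp p -> forall X, supp_rank1 X ->
      X i1 l ^+ K * \prod_k (mxvec X 0 k) ^+ e k =
      \sum_b a b * \prod_k X (val k).1 (val k).2 ^+ b k.
  move=> e; case: (boolP (e \in msupp p)) => ep; last by exists (fun=> 0).
  have eK : (mdeg e <= K)%N by rewrite -ltnS (leq_trans (msize_mdeg_lt ep)).
  by have [a ha] := cross_mono_index (cross_mono_monomial eK); exists a.
exists (fun b => \sum_(e <- msupp p) p@_e * a e b) => X hX.
rewrite /mxeval mevalE mulr_sumr.
under [RHS]eq_bigr => b _ do rewrite mulr_suml.
rewrite exchange_big /=; apply: eq_big_seq => e ep.
rewrite mulrCA ha // mulr_sumr; apply: eq_bigr => b _; by rewrite mulrA.
Qed.

(** If N^e independent functions of degree at most D N exceed in number the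
    monomials in the entries of the cross with exponents at most 2 D N, some
    combination of them vanishes after multiplication by a power of the pivot
    entry, hence vanishes on the irreducible [Z e]. So N^e <= (2 D N + 1)^d for all N, which forces
    e <= d. *)
Lemma supp_rank1_chain_le (Z : nat -> set 'M[F]_(m, n)) e X :
  (forall i, (i <= e)%N -> irreducible_closed (Z i)) ->
  (forall i, (i < e)%N -> (Z i `<` Z i.+1)%classic) ->
  (Z e `<=` supp_rank1)%classic -> Z e X -> X i1 l != 0 ->
  (e <= (#|P| + #|Q|).-1)%N.
Proof.
move=> irr chain ZC ZX X1.
have [D hD] := chain_lin_indep irr chain.
suff H N : (N ^ e <= (2 * (D * N)).+1 ^ (#|P| + #|Q|).-1)%N.
  move: (_.-1) H => d H; rewrite leqNgt; apply/negP => de.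
  pose N := ((2 * D).+1 ^ d).+1.
  have h1 : ((2 * (D * N)).+1 <= (2 * D).+1 * N)%N by rewrite /N; nia.
  have h2 : (N ^ e <= ((2 * D).+1 * N) ^ d)%N.
    by apply: leq_trans (H N) _; case: (d) => [|d'] //; rewrite leq_exp2r.
  have h3 : (N ^ d.+1 <= N ^ e)%N by apply: leq_pexp2l.
  have := leq_trans h3 h2; rewrite expnMn expnS leq_pmul2r ?expn_gt0 //.
  by rewrite ltnn.
have [T [p [cT sp ind]]] := hD N.
have /choice[a ha] := fun t => cross_span (sp t).
rewrite -cT -card_cross leqNgt; apply/negP => lt.
pose B := cross_exp (2 * (D * N)).
have cB : #|{: B}| = ((2 * (D * N)).+1 ^ #|cross|)%N.
  by rewrite card_ffun card_ord card_sig; congr (_ ^ _)%N; apply: eq_card.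
pose M : 'M[F]_(#|T|, #|{: B}|) := \matrix_(t, b) a (enum_val t) (enum_val b).
have /rowV0Pn[v /sub_kermxP vM v0] : kermx M != 0.
  rewrite kermx_eq0 /row_free neq_ltn; apply/orP; left.
  by apply: leq_ltn_trans (rank_leq_col _) _; rewrite cB.
case/eqP: v0; apply/rowP => k; rewrite mxE -(enum_valK k).
apply: (ind (fun t => v 0 (enum_rank t))) => Y ZY.
have pf : polyfun (fun X => \sum_t v 0 (enum_rank t) * mxeval (p t) X).
  apply: polyfun_sum => t; apply: polyfunM; [exact: polyfun_cst|exact: polyfun_mxeval].
have pe : polyfun (fun X : 'M[F]_(m, n) => X i1 l ^+ (D * N)).
  exact/polyfunX/polyfun_entry.
apply: (irreducible_mul (irr e (leqnn _)) pe pf _ ZX _ ZY); last by rewrite expf_neq0.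
move=> W ZW; have CW := ZC _ ZW; rewrite mulr_sumr.
under eq_bigr => t _ do rewrite mulrCA ha // mulr_sumr.
rewrite exchange_big /= big1 // => b _.
under eq_bigr => t _ do rewrite mulrA.
rewrite -mulr_suml; have /rowP/(_ (enum_rank b)) := vM; rewrite !mxE => vMb.
rewrite (_ : \sum_t _ = 0) ?mul0r // -[RHS]vMb.
rewrite [LHS](reindex (@enum_val T predT)) /=; last by apply: onW_bij; apply: enum_val_bij.
by apply: eq_bigr => t _; rewrite mxE enum_valK enum_rankK.
Qed.

End Cross.
End Component.

(** * Rank-one matrices with prescribed support: chains, tangent spaces, smoothness *)

Section Tangent.
Variables (F : numFieldType) (m n : nat) (V : set 'M[F]_(m, n)) (X : 'M[F]_(m, n)).

Lemma poly_ext (p q : {poly F}) : (forall t, p.[t] = q.[t]) -> p = q.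
Proof.
move=> pq; apply/eqP; rewrite -subr_eq0; apply/eqP; apply: contrapT => /eqP/poly_nonroot[t].
by rewrite hornerD hornerN pq subrr eqxx.
Qed.

Lemma tangent_line A : (forall t, V (X + t *: A)) -> tangent_space V X A.
Proof.
move=> hV p pV; have [q [hq <-]] := mxeval_line_deriv p X A.
have -> : q = 0 by apply: poly_ext => t; rewrite -hq horner0; apply: pV.
by rewrite deriv0 horner0.
Qed.

Lemma tangentD A B : tangent_space V X A -> tangent_space V X B -> tangent_space V X (A + B).
Proof.
move=> hA hB p pV; under eq_bigr => k _ do rewrite linearD mxE mulrDr.
by rewrite big_split /= hA // hB // addr0.
Qed.

(** Every polynomial function vanishing on [V] has zero derivative along a tangent
    vector; the derivative is read off any univariate expression [q]. *)
Lemma tangent_deriv A f (q : {poly F}) :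
  polyfun f -> (forall Y, V Y -> f Y = 0) -> tangent_space V X A ->
  (forall t, f (X + t *: A) = q.[t]) -> q^`().[0] = 0.
Proof.
move=> [p hp] fV tA hq; have [q' [hq' dq']] := mxeval_line_deriv p X A.
have -> : q = q' by apply: poly_ext => t; rewrite -hq -hq' hp.
by rewrite dq'; apply: tA => Y /fV; rewrite hp.
Qed.

Lemma tangent_entry0 A i j : (forall Y, V Y -> Y i j = 0) ->
  tangent_space V X A -> A i j = 0.
Proof.
move=> hV tA.
have := @tangent_deriv A _ ((X i j)%:P + A i j *: 'X) (polyfun_entry _ i j) hV tA.
rewrite derivD derivC add0r derivZ derivX hornerZ hornerC mulr1; apply=> t.
by rewrite !hornerE !mxE mulrC.
Qed.

Lemma tangent_minor A i j k l : (forall Y, V Y -> (\rank Y <= 1)%N) ->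
  tangent_space V X A ->
  A i j * X k l + X i j * A k l = A i l * X k j + X i l * A k j.
Proof.
move=> hV tA; apply/eqP; rewrite -subr_eq0; apply/eqP.
pose L i j := (X i j)%:P + A i j *: 'X.
have hL i' j' t : (L i' j').[t] = (X + t *: A) i' j'.
  by rewrite !hornerE !mxE mulrC.
have dL i' j' : (L i' j')^`().[0] = A i' j'.
  by rewrite derivD derivC add0r derivZ derivX hornerZ hornerC mulr1.
have L0 i' j' : (L i' j').[0] = X i' j' by rewrite hL scale0r addr0.
rewrite -(@tangent_deriv A (fun Y => Y i j * Y k l - Y i l * Y k j)
   (L i j * L k l - L i l * L k j)) //.
- rewrite derivB !derivM hornerD hornerN !hornerD !hornerM !dL !L0; ring.
- by apply: polyfunB; apply: polyfunM; apply: polyfun_entry.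
- by move=> Y /hV/rank_le1_minors ->; rewrite subrr.
by move=> t; rewrite hornerD hornerN !hornerM !hL.
Qed.

End Tangent.

Section Smooth.
Variables (F : numFieldType) (m n : nat) (P : {set 'I_m}) (Q : {set 'I_n}).
Variables (i1 : 'I_m) (l : 'I_n) (X : 'M[F]_(m, n)).
Implicit Types E : {set 'I_m * 'I_n}.
Hypotheses (CX : supp_rank1 P Q X) (X1 : X i1 l != 0).

Let i1P : i1 \in P.
Proof. by apply: contraNT X1 => h; rewrite CX.2 // (negPf h). Qed.
Let lQ : l \in Q.
Proof. by apply: contraNT X1 => h; rewrite CX.2 // (negPf h) andbF. Qed.
Let XE i j : X i j = X i l * (X i1 j / X i1 l).
Proof. by have /rank_le1_minors r := CX.1; rewrite mulrA -r mulfK. Qed.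

(** The rank-one matrices whose coordinates on the cross agree with those of [X]
    except at the positions in [E]. The scale of the factors is fixed by
    keeping [a i1 = X i1 l]; the pivot position [(i1, l)] then frees [b l]. *)
Definition slice (E : {set 'I_m * 'I_n}) : set 'M[F]_(m, n) := fun M =>
  exists (a : 'I_m -> F) (b : 'I_n -> F),
    [/\ M = \matrix_(i, j) (a i * b j),
        forall i, ((i, l) \notin E) || (i == i1) -> a i = X i l &
        forall j, (i1, j) \notin E -> b j = X i1 j / X i1 l].

Local Notation cross := (cross P Q i1 l).

Lemma slice_self E : slice E X.
Proof.
exists (fun i => X i l), (fun j => X i1 j / X i1 l); split=> //.
by apply/matrixP => i j; rewrite mxE -XE.
Qed.

Lemma slice_supp_rank1 E : E \subset cross -> (slice E `<=` supp_rank1 P Q)%classic.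
Proof.
move=> sE M [a [b [-> ha hb]]]; split.
  apply/rank_le1_minors => i j k l'; rewrite !mxE; ring.
move=> i j; rewrite mxE negb_and => /orP[iP|jQ].
  rewrite ha; first by rewrite CX.2 ?mul0r // (negPf iP).
  by apply/orP; left; apply: contra iP => /(fintype.subsetP sE); rewrite in_cross // => /andP[].
rewrite hb; first by rewrite [X i1 j]CX.2 ?mul0r ?mulr0 // (negPf jQ) andbF.
by apply: contra jQ => /(fintype.subsetP sE); rewrite in_cross // => /and3P[].
Qed.

Lemma slice_irreducible E : irreducible_closed (zclosure (slice E)).
Proof.
apply: irreducible_zclosure; first by exists X; apply: slice_self.
move=> _ _ [a [b [-> ha hb]]] [a' [b' [-> ha' hb']]].
exists (\matrix_(i, j) (((a i)%:P + (a' i - a i) *: 'X) * ((b j)%:P + (b' j - b j) *: 'X))).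
split.
- by apply/matrixP => i j; rewrite !mxE !hornerE.
- by apply/matrixP => i j; rewrite !mxE !hornerE /=; ring.
move=> t; exists (fun i => a i + (a' i - a i) * t), (fun j => b j + (b' j - b j) * t).
split.
- by apply/matrixP => i j; rewrite !mxE !hornerE.
- by move=> i hi; rewrite ha // ha' // subrr mul0r addr0.
by move=> j hj; rewrite hb // hb' // subrr mul0r addr0.
Qed.

(** A polynomial that on a slice measures how far the coordinate [k] is from that
    of [X]. Off the pivot row it is homogenised by [M i1 l], because the entry
    [M k.1 l] also contains the factor [b l]. *)
Definition coord_defect (k : 'I_m * 'I_n) (M : 'M[F]_(m, n)) :=
  if k.1 == i1 then M i1 k.2 - X i1 k.2
  else M k.1 l * X i1 l - X k.1 l * M i1 l.

Lemma polyfun_coord_defect k : polyfun (coord_defect k).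
Proof.
rewrite /coord_defect; case: (k.1 == i1).
  by apply: polyfunB; [apply: polyfun_entry|apply: polyfun_cst].
by apply: polyfunB; apply: polyfunM; (apply: polyfun_entry || apply: polyfun_cst).
Qed.

Lemma coord_defect_slice E k M : k \in cross -> k \notin E -> slice E M ->
  coord_defect k M = 0.
Proof.
case: k => i j kc kE [a [b [-> ha hb]]]; rewrite /coord_defect /=.
case: (eqVneq i i1) => [ei|ni].
  rewrite !mxE ha ?eqxx ?orbT // hb -?ei // mulrCA divff ?ei // mulr1 subrr //.
move: kc; rewrite in_cross // => /and3P[_ _]; rewrite (negPf ni) /= => /eqP ej.
rewrite ej in kE; rewrite !mxE (ha i) ?kE // (ha i1) ?eqxx ?orbT //; ring.
Qed.

(** The witness differs from [X] in the single coordinate [k]. *)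
Lemma coord_defect_neq0 E k : k \in cross -> k \in E ->
  exists2 M, slice E M & coord_defect k M != 0.
Proof.
case: k => i0 j0 kc kE.
pose a i := X i l + ((i == i0) && (i0 != i1))%:R.
pose b j := X i1 j / X i1 l + ((j == j0) && (i0 == i1))%:R.
exists (\matrix_(i, j) (a i * b j)).
  exists a, b; split=> //.
    move=> i hi; rewrite /a; case: eqP => [ei|]; last by rewrite addr0.
    case: (eqVneq i0 i1) => [|ni]; first by rewrite addr0.
    move: hi; rewrite ei (negPf ni) orbF.
    move: kc; rewrite in_cross // (negPf ni) /= => /and3P[_ _ /eqP ej].
    by rewrite -ej kE.
  move=> j hj; rewrite /b; case: eqP => [ej|]; last by rewrite addr0.
  case: (eqVneq i0 i1) => [ei|ni]; last by rewrite addr0.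
  by move: hj; rewrite ej -ei kE.
rewrite /coord_defect /= !mxE /a /b.
case: (eqVneq i0 i1) => [ei|ni] /=.
  by rewrite eqxx addr0 mulrDr mulrCA divff // !mulr1 addrC addKr.
rewrite eqxx andbF !addr0 divff // !mulr1.
by rewrite mulrDl addrC addKr mul1r.
Qed.

(** Positions of the cross are freed one after the other; the defect of the
    position added last separates consecutive closures. *)
Lemma slice_chain (V : set 'M[F]_(m, n)) :
  (supp_rank1 P Q `<=` V)%classic -> local_chain V X (#|P| + #|Q|).-1.
Proof.
move=> CV; rewrite -(card_cross i1P lQ).
pose E c := [set k in take c (enum cross)]%SET.
have Ecross c : E c \subset cross.
  by apply/fintype.subsetP => k; rewrite inE => /mem_take; rewrite mem_enum.
exists (fun c => zclosure (slice (E c))); split.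
  move=> c _; split; first exact: slice_irreducible.
    exact/sub_zclosure/slice_self.
  apply: subset_trans CV; apply: zclosure_sub; first exact: zariski_closed_supp_rank1.
  exact: slice_supp_rank1.
move=> c cd; have csz : (c < size (enum cross))%N by rewrite -cardE.
pose k := nth (i1, l) (enum cross) c.
have kc : k \in cross by rewrite -mem_enum mem_nth.
have Ek : k \in E c.+1.
  by rewrite inE (take_nth (i1, l) csz) mem_rcons inE eqxx.
have nEk : k \notin E c.
  rewrite inE; apply/negP => /(nthP (i1, l))[c' c'lt].
  rewrite size_take csz in c'lt; rewrite nth_take // => /eqP.
  rewrite nth_uniq ?enum_uniq // ?(ltn_trans c'lt) // => /eqP e.
  by rewrite e ltnn in c'lt.
have EE : E c \subset E c.+1.
  apply/fintype.subsetP => u; rewrite !inE (take_nth (i1, l) csz) mem_rcons inE => ->.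
  by rewrite orbT.
split.
  apply: zclosure_sub; first exact: zclosure_closed.
  move=> M [a [b [-> ha hb]]]; apply: sub_zclosure; exists a, b; split=> //.
    move=> i /orP[h|h]; apply: ha; rewrite ?h ?orbT //.
    by rewrite (contra (fintype.subsetP EE _) h).
  by move=> j h; apply: hb; rewrite (contra (fintype.subsetP EE _) h).
have [M sM dM] := coord_defect_neq0 kc Ek.
move=> /(_ M (sub_zclosure sM)).
have [p hp] := polyfun_coord_defect k.
move=> /(_ p); rewrite hp => h; case/eqP: dM; apply: h => Y sY.
by rewrite hp (coord_defect_slice kc nEk sY).
Qed.


(** The linearised equations at [X]: zero entries, and the minors through the
    pivot. *)
Definition tangent_eqs (A : 'M[F]_(m, n)) :=
  (forall i j, ~~ ((i \in P) && (j \in Q)) -> A i j = 0) /\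
  forall i j, A i j * X i1 l + X i j * A i1 l = A i l * X i1 j + X i l * A i1 j.

Definition cross_coord (v : 'rV[F]_#|cross|) (k : 'I_m * 'I_n) :=
  \sum_c v 0 c * (enum_val c == k)%:R.

(** The tangent vector with given entries on the cross, obtained by solving
    [tangent_eqs] for its other entries. *)
Definition tangent_param (v : 'rV[F]_#|cross|) : 'M[F]_(m, n) :=
  \matrix_(i, j) (if (i \in P) && (j \in Q) then
    (cross_coord v (i, l) * X i1 j + X i l * cross_coord v (i1, j)
      - X i j * cross_coord v (i1, l)) / X i1 l else 0).

Lemma cross_coordE v c : cross_coord v (enum_val c) = v 0 c.
Proof.
rewrite /cross_coord (bigD1 c) //= eqxx mulr1 big1 ?addr0 // => c' cc'.
by rewrite (inj_eq enum_val_inj) (negPf cc') mulr0.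
Qed.

Lemma tangent_param_linear : linear tangent_param.
Proof.
have h a u v k : cross_coord (a *: u + v) k = a * cross_coord u k + cross_coord v k.
  rewrite /cross_coord mulr_sumr -big_split; apply: eq_bigr => c _ /=.
  by rewrite !mxE mulrDl mulrA.
move=> a u v; apply/matrixP => i j; rewrite !mxE !h.
by case: ifP => _; [field | rewrite mulr0 addr0].
Qed.

HB.instance Definition _ :=
  GRing.isLinear.Build F 'rV[F]_#|cross| 'M[F]_(m, n) _ tangent_param tangent_param_linear.

Lemma tangent_param_cross v c :
  tangent_param v (enum_val c).1 (enum_val c).2 = v 0 c.
Proof.
rewrite -cross_coordE; have := enum_valP c; case: (enum_val c) => i j /=.
rewrite in_cross // => /and3P[iP jQ] /orP[/eqP ei|/eqP ej]; rewrite mxE iP jQ /=.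
  by rewrite ei; field.
by rewrite ej; field.
Qed.

Lemma tangent_param_eqs v : tangent_eqs (tangent_param v).
Proof.
split=> i j; first by rewrite mxE => /negPf->.
rewrite !mxE i1P lQ /= andbT.
have [iP|iP] /= := boolP (i \in P); have [jQ|jQ] /= := boolP (j \in Q).
- by field.
- by rewrite (CX.2 i j) ?(CX.2 i1 j) ?(negPf jQ) ?andbF //; ring.
- by rewrite (CX.2 i j) ?(CX.2 i l) ?(negPf iP) //; ring.
by rewrite (CX.2 i j) ?(CX.2 i l) ?(negPf iP) //; ring.
Qed.

Lemma tangent_eqs_param A : tangent_eqs A -> exists v, A = tangent_param v.
Proof.
move=> [supp eqs]; exists (\row_c A (enum_val c).1 (enum_val c).2).
have h k : k \in cross -> cross_coord (\row_c A (enum_val c).1 (enum_val c).2) k = A k.1 k.2.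
  by move=> kc; rewrite -(enum_rankK_in kc kc) cross_coordE mxE.
apply/matrixP => i j; rewrite !mxE; have [/andP[iP jQ]|] := boolP (_ && _); last exact: supp.
rewrite !h ?in_cross // ?iP ?jQ ?i1P ?lQ ?eqxx ?orbT //=.
by apply: (mulIf X1); rewrite mulfVK // -eqs addrK.
Qed.

Definition tangent_vspace : {vspace 'M[F]_(m, n)} := limg (linfun tangent_param).

Lemma tangent_vspaceP A : A \in tangent_vspace <-> tangent_eqs A.
Proof.
split=> [/memv_imgP[v _ ->]|/tangent_eqs_param[v ->]].
  by rewrite lfunE; apply: tangent_param_eqs.
by rewrite -[tangent_param v]lfunE memv_img ?memvf.
Qed.

Lemma dim_tangent_vspace : \dim tangent_vspace = (#|P| + #|Q|).-1.
Proof.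
rewrite limg_dim_eq; first by rewrite dimvf /dim /= mul1n (card_cross i1P lQ).
apply/eqP; rewrite capfv -subv0; apply/subvP => v; rewrite memv_ker lfunE => /eqP v0.
rewrite memv0; apply/eqP/rowP => c; rewrite -tangent_param_cross.
by move/matrixP: v0 => ->; rewrite !mxE.
Qed.

(** A solution splits as a sum of a x' y^T and an x y'^T, and both X + t x' y^T
    and X + t x y'^T stay on the component for all t. *)
Lemma tangent_eqs_tangent V A : (supp_rank1 P Q `<=` V)%classic ->
  tangent_eqs A -> tangent_space V X A.
Proof.
move=> CV [supp eqs].
pose A1 := \matrix_(i, j) (A i l * (X i1 j / X i1 l)).
pose A2 := \matrix_(i, j) (X i l * ((A i1 j - A i1 l * (X i1 j / X i1 l)) / X i1 l)).
have -> : A = A1 + A2.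
  apply/matrixP => i j; rewrite !mxE; apply: (mulIf X1).
  have -> : A i j * X i1 l = A i l * X i1 j + X i l * A i1 j - X i j * A i1 l.
    by rewrite -eqs addrK.
  by rewrite (XE i j); field.
have row0 i : i \notin P -> A i l = 0 /\ X i l = 0.
  by move=> iP; rewrite supp ?CX.2 ?(negPf iP).
have col0 j : j \notin Q -> A i1 j = 0 /\ X i1 j = 0.
  by move=> jQ; rewrite supp ?CX.2 ?(negPf jQ) ?andbF.
apply: tangentD; apply: tangent_line => t; apply: CV; split.
- apply/rank_le1_minors => i j k k'; rewrite !mxE (XE i j) (XE k k') (XE i k') (XE k j); ring.
- move=> i j; rewrite !mxE (XE i j) negb_and.
  by case/orP=> [/row0[e1 e2]|/col0[e1 e2]]; rewrite ?e1 ?e2; ring.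
- apply/rank_le1_minors => i j k k'; rewrite !mxE (XE i j) (XE k k') (XE i k') (XE k j); ring.
move=> i j; rewrite !mxE (XE i j) negb_and.
  by case/orP=> [/row0[e1 e2]|/col0[e1 e2]]; rewrite ?e1 ?e2; ring.
Qed.

Variable V C' : set 'M[F]_(m, n).
Hypotheses (CV : (supp_rank1 P Q `<=` V)%classic)
  (VC : (V `<=` supp_rank1 P Q `|` C')%classic)
  (clC' : zariski_closed C') (nC'X : ~ C' X)
  (Vrank : forall Y, V Y -> (\rank Y <= 1)%N)
  (Vsupp : forall A, tangent_space V X A ->
     forall i j, ~~ ((i \in P) && (j \in Q)) -> A i j = 0).

Lemma tangent_spaceE A : tangent_space V X A <-> tangent_eqs A.
Proof.
split; last exact: tangent_eqs_tangent.
by move=> tA; split=> [|i j]; [apply: Vsupp | apply: (tangent_minor _ _ _ _ Vrank tA)].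
Qed.

(** An irreducible closed set in [V] through [X] is not contained in [C'], so it
    lies on the component, where [supp_rank1_chain_le] bounds chains. *)
Lemma smooth_component : smooth_point V X.
Proof.
split; first exact: CV.
exists tangent_vspace; split=> [A|].
  by rewrite tangent_vspaceP tangent_spaceE.
rewrite dim_tangent_vspace; split; first exact: slice_chain.
move=> e [Z [hZ chain]].
have irr i : (i <= e)%N -> irreducible_closed (Z i) by case/hZ.
have [[clZ neZ irrZ] ZX ZV] := hZ e (leqnn e).
apply: (@supp_rank1_chain_le F m n P Q i1 l i1P lQ Z e X) => //.
have := irrZ _ _ (@zariski_closed_supp_rank1 F m n P Q) clC'.
by case=> [Y /ZV/VC //||ZC'] //; case: nC'X; apply: ZC'.
Qed.

End Smooth.

(** * Critical rank-one matrices and eigenvectors of the Gram matrix *)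

Section Critical.
Variable F : numClosedFieldType.

(** The tangent directions at [X] of the matrices of rank at most one are
    spanned by the matrices [B *m X] and [X *m B]; orthogonality of [W - X] to
    these amounts to the two matrix equations. *)
Definition rank1_critical m n (W X : 'M[F]_(m, n)) :=
  [/\ (\rank X <= 1)%N, X != 0, (W - X) *m X^T = 0 & X^T *m (W - X) = 0].

(** Its kernel is the largest subspace stable under [G] on which [u] vanishes.
    If it is invertible, no eigenvector of [G] is killed by [u]. *)
Definition krylov q (u : 'rV[F]_q.+1) (G : 'M[F]_q.+1) : 'M[F]_q.+1 :=
  \matrix_k (u *m G ^+ k).

Lemma horner_mx_eigen q (G : 'M[F]_q.+1) (z : 'cV[F]_q.+1) a p :
  G *m z = a *: z -> horner_mx G p *m z = p.[a] *: z.
Proof.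
move=> Gz; elim/poly_ind: p => [|p c IH]; first by rewrite rmorph0 mul0mx horner0 scale0r.
rewrite rmorphD rmorphM /= horner_mx_X horner_mx_C mulmxDl mul_scalar_mx.
rewrite -mulmxE -mulmxA Gz -scalemxAr IH scalerA -scalerDl; congr (_ *: _).
by rewrite !hornerE mulrC.
Qed.

Lemma krylov_eigen q (u : 'rV[F]_q.+1) (G : 'M[F]_q.+1) (z : 'cV[F]_q.+1) a :
  \det (krylov u G) != 0 -> G *m z = a *: z -> u *m z = 0 -> z = 0.
Proof.
move=> dK Gz uz.
have Kz : krylov u G *m z = 0.
  apply/row_matrixP => k; rewrite row_mul rowK row0 -mulmxA.
  have -> : G ^+ k *m z = a ^+ k *: z.
    elim: (k : nat) => [|j IH]; first by rewrite expr0 mul1mx scale1r.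
    by rewrite exprSr -mulmxE -mulmxA Gz -scalemxAr IH scalerA -exprS.
  by rewrite -scalemxAr uz scaler0.
by rewrite -[z](@mulKmx _ _ _ (krylov u G)) ?Kz ?mulmx0 // unitmxE unitfE.
Qed.

Section Tall.
Variables (p q : nat) (W : 'M[F]_(p.+1, q.+1)).
Implicit Types z : 'cV[F]_q.+1.
Let G : 'M[F]_q.+1 := W^T *m W.
Let chi := char_poly G.

(** Respectively: the eigenvalues are simple, the eigenvectors z of the Gram
    matrix have z_0 <> 0, and the vectors W z have (W z)_0 <> 0. *)
Definition spectrally_general :=
  [&& \det (horner_mx G chi^`()) != 0,
      \det (krylov (delta_mx 0 0) G) != 0 & \det (krylov (row 0 W) G) != 0].

Hypothesis nd : spectrally_general.

Let chi0 : \det (horner_mx G chi^`()) != 0. Proof. by case/and3P: nd. Qed.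
Let Ke : \det (krylov (delta_mx 0 0) G) != 0. Proof. by case/and3P: nd. Qed.
Let Kr : \det (krylov (row 0 W) G) != 0. Proof. by case/and3P: nd. Qed.

Let GT : G^T = G. Proof. by rewrite trmx_mul trmxK. Qed.

Let mul_eq0 k (M : 'M[F]_k) (z : 'cV[F]_k) : \det M != 0 -> M *m z = 0 -> z = 0.
Proof. by move=> dM Mz; rewrite -[z](@mulKmx _ _ _ M) ?Mz ?mulmx0 // unitmxE unitfE. Qed.

Let eigen_root z a : G *m z = a *: z -> z != 0 -> root chi a.
Proof.
move=> Gz z0; rewrite -eigenvalue_root_char; apply/eigenvalueP; exists z^T.
  by rewrite -[RHS]linearZ /= -Gz trmx_mul GT.
by rewrite -(inj_eq trmx_inj) trmxK trmx0.
Qed.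

Let root_eigen a : root chi a -> exists2 z : 'cV[F]_q.+1, G *m z = a *: z & z != 0.
Proof.
rewrite -eigenvalue_root_char => /eigenvalueP[v Gv v0]; exists v^T.
  by rewrite -GT -trmx_mul Gv linearZ.
by rewrite -(inj_eq trmx_inj) trmxK trmx0.
Qed.

Let root_simple a : root chi a -> chi^`().[a] != 0.
Proof.
move=> /root_eigen[z Gz z0]; apply: contraNneq z0 => e; apply/eqP.
by apply: (mul_eq0 chi0); rewrite (horner_mx_eigen _ Gz) e scale0r.
Qed.

Let coord0 k (z : 'cV[F]_k.+1) : (delta_mx 0 0 : 'rV_k.+1) *m z = (z 0 0)%:M.
Proof. by rewrite -rowE; apply/matrixP => i j; rewrite !mxE !ord1 eqxx. Qed.

Let eigen_coord z a : G *m z = a *: z -> z != 0 -> z 0 0 != 0.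
Proof.
move=> Gz; apply: contraNneq => e; apply/eqP; apply: (krylov_eigen Ke Gz).
by rewrite coord0 e; apply/matrixP => i j; rewrite !mxE mul0rn.
Qed.

(** Subtracting a multiple of [z] from [z'] makes the coordinate 0 vanish, so
    the Krylov condition makes the eigenspaces lines. *)
Let eigen_line z (z' : 'cV[F]_q.+1) a : G *m z = a *: z -> z != 0 -> G *m z' = a *: z' ->
  exists c, z' = c *: z.
Proof.
move=> Gz z0 Gz'; exists (z' 0 0 / z 0 0); apply/eqP; rewrite -subr_eq0; apply/eqP.
apply: (krylov_eigen (a := a) Ke).
  by rewrite mulmxBr -scalemxAr Gz Gz' scalerBr !scalerA [a * _]mulrC.
rewrite coord0 !mxE mulfVK ?subrr ?(eigen_coord Gz) //.
by apply/matrixP => i j; rewrite !mxE mul0rn.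
Qed.

(** Write chi = (X - a) s, so that s(a) = chi'(a) is nonzero. The image of s(G)
    is in the eigenline of [z], and G is symmetric; if [z] were isotropic then
    s(a) w^T z = (s(G) w)^T z = 0 for every w, whence [z = 0]. *)
Let eigen_norm z a : G *m z = a *: z -> z != 0 -> (z^T *m z) 0 0 != 0.
Proof.
move=> Gz z0; apply: contraNneq (z0) => nz.
have ra := eigen_root Gz z0.
have [s chiE] := factor_theorem _ _ ra.
have sa : s.[a] != 0.
  have := root_simple ra; rewrite chiE derivM derivXsubC mulr1 hornerD hornerM.
  by rewrite hornerXsubC subrr mulr0 add0r.
have key (w : 'cV[F]_q.+1) : (w^T *m z) 0 0 = 0.
  have Gsw : G *m (horner_mx G s *m w) = a *: (horner_mx G s *m w).
    apply/eqP; rewrite -subr_eq0; apply/eqP.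
    have := Cayley_Hamilton G; rewrite -/chi chiE mulrC rmorphM /= rmorphB /=.
    rewrite horner_mx_X horner_mx_C => /(congr1 (mulmx^~ w)).
    by rewrite mul0mx -mulmxE -mulmxA mulmxBl mul_scalar_mx.
  have [c cE] := eigen_line Gz z0 Gsw.
  have h : ((horner_mx G s *m w)^T *m z) 0 0 = s.[a] * (w^T *m z) 0 0.
    have sT : (horner_mx G s)^T = horner_mx G s.
      elim/poly_ind: s {chiE sa Gsw cE} => [|s b IH]; first by rewrite rmorph0 trmx0.
      rewrite rmorphD rmorphM /= horner_mx_X horner_mx_C linearD /= tr_scalar_mx.
      by rewrite -mulmxE trmx_mul IH GT; congr (_ + _); apply/esym/comm_horner_mx.
    by rewrite trmx_mul sT -mulmxA (horner_mx_eigen _ Gz) -scalemxAr mxE.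
  move: h; rewrite cE linearZ /= -scalemxAl mxE nz mulr0 => /esym/eqP.
  by rewrite mulf_eq0 (negPf sa) => /eqP.
apply/eqP/matrixP => i j; rewrite ord1 [RHS]mxE -(key (delta_mx i 0)).
by rewrite trmx_delta -rowE mxE.
Qed.

Definition critical_of (z : 'cV[F]_q.+1) : 'M[F]_(p.+1, q.+1) :=
  ((z^T *m z) 0 0)^-1 *: (W *m z *m z^T).

Lemma critical_ofP z a : G *m z = a *: z -> z != 0 ->
  rank1_critical W (critical_of z) /\ (critical_of z) 0 0 != 0.
Proof.
move=> Gz z0; set N := (z^T *m z) 0 0.
have N0 : N != 0 by apply: (eigen_norm Gz).
have Wz0 : (W *m z) 0 0 != 0.
  apply: contraNneq z0 => e; apply/eqP; apply: (krylov_eigen Kr Gz).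
  by rewrite -row_mul; apply/matrixP => i j; rewrite !ord1 mxE e mxE.
have X00 : (critical_of z) 0 0 != 0.
  rewrite mxE mulf_neq0 ?invr_eq0 // mxE big_ord1 mulf_neq0 //.
  by rewrite mxE (eigen_coord Gz).
have XT : (critical_of z)^T = N^-1 *: (z *m (W *m z)^T).
  by rewrite linearZ /= trmx_mul trmxK.
split=> //; split.
- by apply: leq_trans (mxrank_scale _ _) _; apply: mulmx_max_rank.
- by apply: contraNneq X00 => ->; rewrite mxE.
- rewrite XT -scalemxAr mulmxA /critical_of -/N.
  rewrite mulmxBl -scalemxAl -[_ *m z^T *m z]mulmxA (mx11_scalar (z^T *m z)) -/N mul_mx_scalar.
  by rewrite scalerA mulVf // scale1r subrr mul0mx scaler0.
have zG : (W *m z)^T *m W = a *: z^T.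
  by rewrite trmx_mul -mulmxA -/G -[RHS]linearZ /= -Gz trmx_mul GT.
have zGz : (W *m z)^T *m (W *m z *m z^T) = (a * N) *: z^T.
  rewrite 2!mulmxA zG -!scalemxAl (mx11_scalar (z^T *m z)) -/N mul_scalar_mx.
  by rewrite scalerA.
rewrite XT -scalemxAl /critical_of -/N -mulmxA mulmxBr -scalemxAr zG zGz.
by rewrite scalerA mulrCA mulVf // mulr1 subrr mulmx0 scaler0.
Qed.

(** With X = x z^T, the two equations become W z = (z^T z) x and
    W^T x = (x^T x) z. *)
Lemma critical_ofW X : rank1_critical W X ->
  exists2 a, root chi a & exists2 z, G *m z = a *: z & z != 0 /\ X = critical_of z.
Proof.
case=> rX X0 e1 e2; have [i [j Xij]] := mx_neq0P X0.
have XE := rank1_factor rX Xij; set x := col j X in XE; set y := _ *: _ in XE.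
pose z := y^T; have yE : y = z^T by rewrite trmxK.
have XT : X^T = z *m x^T by rewrite {1}XE trmx_mul.
have x0 : x i 0 != 0 by rewrite mxE.
have zj : z j 0 = 1 by rewrite !mxE mulVf.
have z0 : z != 0.
  by apply/negP => /eqP/matrixP/(_ j 0)/eqP; rewrite zj mxE oner_eq0.
have Wz : W *m z = (z^T *m z) 0 0 *: x.
  have : (W - X) *m z = 0.
    rewrite XT mulmxA in e1; move: e1; move: (_ *m z) => u /matrixP h.
    apply/matrixP => k k'; rewrite ord1 [RHS]mxE.
    have := h k i; rewrite !mxE big_ord1 => /eqP; rewrite mulf_eq0 [x^T _ _]mxE.
    by move=> /orP[/eqP //|]; rewrite (negPf x0).
  rewrite mulmxBl => /eqP; rewrite subr_eq0 => /eqP ->.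
  by rewrite XE yE -mulmxA (mx11_scalar (z^T *m z)) mul_mx_scalar [in RHS]mxE eqxx mulr1n.
have xW : W^T *m x = (x^T *m x) 0 0 *: z.
  have : x^T *m (W - X) = 0.
    rewrite XT -mulmxA in e2; move: e2; move: (x^T *m _) => u /matrixP h.
    apply/matrixP => k k'; rewrite ord1 [RHS]mxE.
    by have := h j k'; rewrite !mxE big_ord1 zj mul1r.
  rewrite mulmxBr => /eqP; rewrite subr_eq0 => /eqP/(congr1 trmx).
  rewrite trmx_mul trmxK => ->; rewrite XE mulmxA (mx11_scalar (x^T *m x)) mul_scalar_mx.
  by rewrite linearZ /= [in RHS]mxE eqxx mulr1n.
set a := (z^T *m z) 0 0 in Wz; set b := (x^T *m x) 0 0 in xW.
have Gz : G *m z = (a * b) *: z by rewrite -mulmxA Wz -scalemxAr xW scalerA.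
exists (a * b); first exact: (eigen_root Gz).
exists z => //; split=> //.
have a0 : a != 0 by apply: (eigen_norm Gz).
by rewrite /critical_of -/a Wz -scalemxAl scalerA mulVf // scale1r -yE.
Qed.

Lemma critical_count : exists s : seq 'M[F]_(p.+1, q.+1),
  [/\ uniq s, size s = q.+1, forall X, X \in s <-> rank1_critical W X &
      forall X, X \in s -> X 0 0 != 0].
Proof.
have [r chiE] := closed_field_poly_normal chi.
have mchi : chi \is monic := char_poly_monic G.
rewrite (monicP mchi) scale1r in chiE.
have rroot a : (a \in r) = root chi a by rewrite chiE root_prod_XsubC.
have ur : uniq r.
  rewrite -separable_prod_XsubC -chiE unlock; apply/Pdiv.ClosedField.coprimepP => a.
  exact: root_simple.
have szr : size r = q.+1.
  by apply: succn_inj; rewrite -(size_prod_XsubC _ id) -chiE size_char_poly.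
have /choice[z hz] a : exists z : 'cV[F]_q.+1, a \in r -> G *m z = a *: z /\ z != 0.
  have [|_] := boolP (a \in r); last by exists 0.
  by rewrite rroot => /root_eigen[z]; exists z.
exists [seq critical_of (z a) | a <- r]; split.
- rewrite map_inj_in_uniq // => a b ra rb.
  have [Ga za] := hz a ra; have [Gb zb] := hz b rb.
  have H c v : G *m v = c *: v -> critical_of v *m G = c *: critical_of v.
    move=> Gv; rewrite /critical_of -scalemxAl -mulmxA -{1}GT -trmx_mul Gv linearZ /=.
    by rewrite -scalemxAr !scalerA mulrC.
  move=> e; have := H _ _ Ga; rewrite e (H _ _ Gb) => /eqP.
  rewrite -subr_eq0 -scalerBl scaler_eq0 subr_eq0 => /orP[/eqP //|/eqP X0].
  by have [[_ /eqP]] := critical_ofP Gb zb.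
- by rewrite size_map.
- move=> X; split=> [/mapP[a /hz[Ga za] ->]|]; first by case: (critical_ofP Ga za).
  move=> /critical_ofW[a ra [w Gw [w0 ->]]]; apply/mapP; exists a; first by rewrite rroot.
  have ra' : a \in r by rewrite rroot.
  have [Ga za] := hz a ra'; have [c wE] := eigen_line Ga za Gw.
  have c0 : c != 0 by apply: contraNneq w0 => e; rewrite wE e scale0r.
  have N0 := eigen_norm Ga za.
  have wT : w^T = c *: (z a)^T by rewrite wE linearZ.
  have wN : (w^T *m w) 0 0 = c * c * ((z a)^T *m z a) 0 0.
    by rewrite wT wE -scalemxAl -scalemxAr scalerA mxE.
  have wW : W *m w *m w^T = (c * c) *: (W *m z a *m (z a)^T).
    by rewrite wT wE -!scalemxAr -scalemxAl scalerA.
  by rewrite /critical_of wN wW scalerA; congr (_ *: _); field; rewrite c0 N0.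
by move=> X /mapP[a /hz[Ga za] ->]; case: (critical_ofP Ga za).
Qed.

End Tall.
End Critical.

(** * Genericity of the spectral conditions *)

Section CoefPolyfun.
Variables (F : fieldType) (m n : nat).

(** Needed for the coefficients of characteristic polynomials. *)
Definition coef_polyfun (f : 'M[F]_(m, n) -> {poly F}) :=
  forall k, polyfun (fun X => (f X)`_k).

Lemma coef_polyfunM f g : coef_polyfun f -> coef_polyfun g ->
  coef_polyfun (fun X => f X * g X).
Proof.
move=> hf hg k.
apply: (@polyfun_ext _ _ _ (fun X => \sum_(j < k.+1) (f X)`_j * (g X)`_(k - j))).
  by move=> X; rewrite coefM.
by apply: polyfun_sum => j; apply: polyfunM.
Qed.

Lemma coef_polyfun_cst c : coef_polyfun (fun _ => c).
Proof. by move=> k; apply: polyfun_cst. Qed.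

Lemma coef_polyfun_sum (I : Type) (r : seq I) (f : I -> 'M[F]_(m, n) -> {poly F}) :
  (forall i, coef_polyfun (f i)) -> coef_polyfun (fun X => \sum_(i <- r) f i X).
Proof.
move=> hf k; apply: (@polyfun_ext _ _ _ (fun X => \sum_(i <- r) (f i X)`_k)).
  by move=> X; rewrite coef_sum.
by apply: polyfun_sum => i; apply: hf.
Qed.

Lemma coef_polyfun_prod (I : Type) (r : seq I) (f : I -> 'M[F]_(m, n) -> {poly F}) :
  (forall i, coef_polyfun (f i)) -> coef_polyfun (fun X => \prod_(i <- r) f i X).
Proof.
move=> hf; elim: r => [|i r IH] k.
  by apply: (polyfun_ext _ (polyfun_cst m n ((1 : {poly F})`_k))) => X; rewrite big_nil.
apply: (polyfun_ext _ (coef_polyfunM (hf i) IH k)) => X.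
by rewrite big_cons.
Qed.

Lemma coef_polyfun_det q (f : 'M[F]_(m, n) -> 'M[{poly F}]_q) :
  (forall i j, coef_polyfun (fun X => f X i j)) ->
  coef_polyfun (fun X => \det (f X)).
Proof.
move=> hf; apply: coef_polyfun_sum => s; apply: coef_polyfunM; first exact: coef_polyfun_cst.
exact: coef_polyfun_prod.
Qed.

Lemma coef_polyfun_char_poly q (f : 'M[F]_(m, n) -> 'M[F]_q) :
  (forall i j, polyfun (fun X => f X i j)) ->
  coef_polyfun (fun X => char_poly (f X)).
Proof.
move=> hf; apply: coef_polyfun_det => i j k.
apply: (@polyfun_ext _ _ _ (fun X =>
   ('X *+ (i == j) : {poly F})`_k - f X i j * (k == 0%N)%:R)).
  by move=> X; rewrite !mxE coefB coefC; case: (k == 0%N); rewrite ?mulr1 ?mulr0.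
apply: polyfunB; first exact: polyfun_cst.
by apply: polyfunM => //; apply: polyfun_cst.
Qed.

Lemma polyfun_expmx q (f : 'M[F]_(m, n) -> 'M[F]_q.+1) k :
  (forall i j, polyfun (fun X => f X i j)) ->
  forall i j, polyfun (fun X => (f X ^+ k) i j).
Proof.
move=> hf; elim: k => [|k IH] i j.
  by apply: (polyfun_ext _ (polyfun_cst m n ((1 : 'M[F]_q.+1) i j))) => X; rewrite expr0.
by apply: (polyfun_ext _ (polyfun_mulmx hf IH i j)) => X; rewrite exprS.
Qed.

Lemma polyfun_det_krylov q (u : 'M[F]_(m, n) -> 'rV[F]_q.+1)
    (f : 'M[F]_(m, n) -> 'M[F]_q.+1) :
  (forall i j, polyfun (fun X => u X i j)) ->
  (forall i j, polyfun (fun X => f X i j)) ->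
  polyfun (fun X => \det (\matrix_(k < q.+1) (u X *m f X ^+ k))).
Proof.
move=> hu hf; apply: polyfun_det => k j.
apply: (polyfun_ext _ (polyfun_mulmx hu (polyfun_expmx k hf) 0 j)) => X.
by rewrite [RHS]mxE.
Qed.

Lemma horner_mx_sum N q (A : 'M[F]_q.+1) (p : {poly F}) : (size p <= N)%N ->
  horner_mx A p = \sum_(k < N) p`_k *: A ^+ k.
Proof.
move=> sp; have {1}-> : p = \sum_(k < N) p`_k *: 'X^k.
  rewrite -poly_def; apply/polyP => k; rewrite coef_poly.
  by case: ltnP => // Nk; rewrite nth_default // (leq_trans sp).
rewrite linear_sum; apply: eq_bigr => k _.
by rewrite linearZ /= rmorphXn /= horner_mx_X.
Qed.

Lemma polyfun_det_horner_char_deriv q (f : 'M[F]_(m, n) -> 'M[F]_q.+1) :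
  (forall i j, polyfun (fun X => f X i j)) ->
  polyfun (fun X => \det (horner_mx (f X) (char_poly (f X))^`())).
Proof.
move=> hf; apply: polyfun_det => i j.
apply: (@polyfun_ext _ _ _ (fun X =>
  \sum_(k < q.+1) ((char_poly (f X))`_k.+1 *+ k.+1) * (f X ^+ k) i j)).
  move=> X; rewrite (horner_mx_sum (N := q.+1)); last first.
    rewrite -ltnS -(size_char_poly (f X)) lt_size_deriv //.
    exact/monic_neq0/char_poly_monic.
  by rewrite summxE; apply: eq_bigr => k _; rewrite [RHS]mxE coef_deriv.
apply: polyfun_sum => k; apply: polyfunM; last exact: polyfun_expmx.
apply: (@polyfun_ext _ _ _ (fun X => k.+1%:R * (char_poly (f X))`_k.+1)).
  by move=> X; rewrite mulr_natl.
by apply: polyfunM; [exact: polyfun_cst | exact: coef_polyfun_char_poly].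
Qed.
End CoefPolyfun.

Section Generic.
Variable F : numClosedFieldType.
Variables (p q : nat) (qp : (q <= p)%N).

Let gram (W : 'M[F]_(p.+1, q.+1)) := W^T *m W.

Let polyfun_gram i j : polyfun (fun W => gram W i j).
Proof.
apply: polyfun_mulmx => a b; last exact: polyfun_entry.
by apply: (polyfun_ext _ (polyfun_entry F b a)) => X; rewrite mxE.
Qed.

Lemma gram_sum W i j : gram W i j = \sum_k W k i * W k j.
Proof. by rewrite mxE; apply: eq_bigr => k _; rewrite mxE. Qed.

(** Witness: the diagonal matrix with entries 1, 2, ..., whose Gram matrix has the
    distinct eigenvalues 1, 4, 9, ... *)
Lemma generic_simple_spectrum :
  generic (fun W : 'M[F]_(p.+1, q.+1) =>
    \det (horner_mx (gram W) (char_poly (gram W))^`()) != 0).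
Proof.
eexists; split; first exact: (polyfun_det_horner_char_deriv polyfun_gram); last by [].
pose d : 'rV[F]_q.+1 := \row_j (j.+1 ^ 2)%:R.
exists (\matrix_(i, j) ((i == j :> nat)%:R * j.+1%:R)).
set W := \matrix_(_, _) _.
have -> : gram W = diag_mx d.
  apply/matrixP => i j; rewrite gram_sum !mxE.
  rewrite (bigD1 (widen_ord (qp : q.+1 <= p.+1)%N j)) //= !mxE eqxx mul1r big1 ?addr0.
    rewrite eq_sym -val_eqE; case: eqP => [->|]; last by rewrite !mul0r.
    by rewrite mul1r natrX expr2.
  by move=> k; rewrite -val_eqE /= !mxE => /negPf ->; rewrite mul0r mulr0.
rewrite horner_mx_diag det_diag prodf_seq_neq0; apply/allP => i _ /=.
rewrite !mxE -/(root _ _) -/d.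
have chiE : char_poly (diag_mx d) = \prod_(x <- [seq d 0 j | j <- enum 'I_q.+1]) ('X - x%:P).
  rewrite char_poly_trig ?diag_mx_is_trig // big_map big_enum.
  by apply: eq_bigr => j _; rewrite mxE eqxx mulr1n.
have : separable_poly (char_poly (diag_mx d)).
  rewrite chiE separable_prod_XsubC map_inj_uniq ?enum_uniq // => j k.
  rewrite !mxE => /eqP; rewrite eqr_nat eqn_exp2r // eqSS => /eqP h.
  exact: val_inj.
rewrite unlock => /Pdiv.ClosedField.coprimepP; apply.
rewrite chiE root_prod_XsubC; apply/mapP; exists i; rewrite ?mem_enum //.
by rewrite mxE.
Qed.

(** Witness: the lower bidiagonal matrix of ones. Its first row is the first basis
    vector, so both Krylov matrices agree, and its Gram matrix is tridiagonal
    with ones next to the diagonal, so the Krylov matrix is lower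
    unitriangular. *)
Lemma generic_krylov :
  generic (fun W : 'M[F]_(p.+1, q.+1) =>
    \det (krylov (delta_mx 0 0) (gram W)) != 0 /\
    \det (krylov (row 0 W) (gram W)) != 0).
Proof.
pose W : 'M[F]_(p.+1, q.+1) := \matrix_(i, j) ((i == j :> nat)%:R + (i == j.+1 :> nat)%:R).
have rW : row 0 W = delta_mx 0 0.
  by apply/rowP => j; rewrite !mxE /= addr0 eq_sym -val_eqE.
have G0 (a b : 'I_q.+1) : (a.+1 < b)%N -> gram W a b = 0.
  move=> ab; rewrite gram_sum big1 // => k _; rewrite !mxE.
  case: (eqVneq (k : nat) b) => [kb|_].
    have -> : (k == a :> nat) = false by lia.
    have -> : (k == a.+1 :> nat) = false by lia.
    by rewrite addr0 mul0r.
  case: (eqVneq (k : nat) b.+1) => [kb|_]; last by rewrite addr0 mulr0.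
  have -> : (k == a :> nat) = false by lia.
  have -> : (k == a.+1 :> nat) = false by lia.
  by rewrite addr0 mul0r.
have G1 (a b : 'I_q.+1) : b = a.+1 :> nat -> gram W a b = 1.
  move=> ab; rewrite gram_sum (bigD1 (widen_ord (qp : q.+1 <= p.+1)%N b)) //= !mxE /=.
  rewrite ab eqxx big1 ?addr0.
    have -> : (a.+1 == a :> nat) = false by lia.
    have -> : (a.+1 == a.+2 :> nat) = false by lia.
    by rewrite add0r addr0 mulr1.
  move=> k; rewrite -val_eqE /= !mxE ab => /negPf ->.
  rewrite addr0 add0r; case: (eqVneq (k : nat) a) => [ka|_]; last by rewrite mul0r.
  have -> : (k == a.+2 :> nat) = false by lia.
  by rewrite mulr0.
have Kk k (b : 'I_q.+1) : (k <= b)%N ->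
    ((delta_mx 0 0 : 'rV_q.+1) *m gram W ^+ k) 0 b = (k == b :> nat)%:R.
  elim: k b => [|k IH] b kb.
    by rewrite expr0 mulmx1 mxE eqxx eq_sym -val_eqE.
  rewrite exprSr -mulmxE mulmxA mxE.
  have kq : (k < q.+1)%N by apply: leq_trans (ltn_ord b); rewrite ltnS ltnW.
  rewrite (bigD1 (Ordinal kq)) //= IH //= eqxx mul1r big1 ?addr0; last first.
    move=> j; rewrite -val_eqE /= => jk; have [jlt|jge] := ltnP j k.
      by rewrite G0 ?mulr0 //; lia.
    by rewrite IH // eq_sym (negPf jk) mul0r.
  move: kb; rewrite leq_eqVlt => /orP[/eqP kb|kb]; last by rewrite G0 // (ltn_eqF kb).
  by rewrite G1 //= kb eqxx.
have dK : \det (krylov (delta_mx 0 0) (gram W)) = 1.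
  rewrite det_trig; last by apply/is_trig_mxP => k b kb; rewrite mxE Kk ?(ltn_eqF kb) // ltnW.
  by rewrite big1 // => k _; rewrite mxE Kk // eqxx.
apply: generic_and; eexists; split.
- apply: (polyfun_det_krylov (u := fun _ => delta_mx 0 0)) polyfun_gram => a b; exact: polyfun_cst.
- by exists W; rewrite -/(krylov _ _) dK oner_eq0.
- by [].
- apply: (polyfun_det_krylov (u := row 0)) polyfun_gram => a b.
  by apply: (polyfun_ext _ (polyfun_entry F 0 b)) => X; rewrite mxE.
- by exists W; rewrite -/(krylov _ _) rW dK oner_eq0.
by [].
Qed.

Lemma generic_spectrally_general : generic (fun W : 'M[F]_(p.+1, q.+1) => spectrally_general W).
Proof.
apply: generic_weaken (generic_and generic_simple_spectrum generic_krylov) => W.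
by case=> h1 [h2 h3]; apply/and3P.
Qed.

Lemma generic_critical_count :
  generic (fun W : 'M[F]_(p.+1, q.+1) => exists s : seq 'M[F]_(p.+1, q.+1),
    [/\ uniq s, size s = q.+1, forall X, X \in s <-> rank1_critical W X &
      forall X, X \in s -> X 0 0 != 0]).
Proof. exact: generic_weaken (@critical_count F p q) generic_spectrally_general. Qed.

End Generic.

(** * Critical points on one component *)

Section Count.
Variable F : numClosedFieldType.

Lemma rank1_critical_tr m n (W X : 'M[F]_(m, n)) :
  rank1_critical W^T X^T <-> rank1_critical W X.
Proof.
suff h m' n' (W' X' : 'M[F]_(m', n')) : rank1_critical W' X' -> rank1_critical W'^T X'^T.
  by split=> [/h|/h //]; rewrite !trmxK.
case=> r X0 e1 e2; split; first by rewrite mxrank_tr.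
- by rewrite -(inj_eq trmx_inj) trmxK trmx0.
- by rewrite -linearB /= -trmx_mul e2 trmx0.
by rewrite -linearB /= -trmx_mul e1 trmx0.
Qed.

Lemma generic_rank1_critical p q :
  generic (fun W : 'M[F]_(p.+1, q.+1) => exists s : seq 'M[F]_(p.+1, q.+1),
    [/\ uniq s, size s = minn p.+1 q.+1, forall X, X \in s <-> rank1_critical W X &
      forall X, X \in s -> X 0 0 != 0]).
Proof.
have [qp|/ltnW pq] := leqP q p.
  apply: generic_weaken (generic_critical_count F qp) => W.
  by have -> : minn p.+1 q.+1 = q.+1 by lia.
have := generic_critical_count F pq.
move=> /(@generic_comp _ p.+1 q.+1 _ _ _ trmx); have -> : minn p.+1 q.+1 = p.+1 by lia.
move=> h; apply: generic_weaken (h _ _).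
- move=> W [s [us ss hs s0]]; exists (map trmx s); split.
  + by rewrite map_inj_uniq //; apply: trmx_inj.
  + by rewrite size_map.
  + by move=> X; rewrite -rank1_critical_tr -hs -{1}[X]trmxK mem_map //; apply: trmx_inj.
  by move=> _ /mapP[Y /s0 Y0 ->]; rewrite mxE.
- by move=> i j; apply: (polyfun_ext _ (polyfun_entry F j i)) => X; rewrite mxE.
by move=> W; exists W^T; rewrite trmxK.
Qed.

End Count.

(** Starting the enumeration at a chosen element lets the entry at position 0 of
    the submatrix be any prescribed entry of the component. *)
Lemma enum_from (T : finType) (P : {set T}) (x : T) p : x \in P -> #|P| = p.+1 ->
  exists f : 'I_p.+1 -> T, [/\ injective f, f ord0 = x & forall y, y \in P <-> exists a, f a = y].
Proof.
move=> xP cP; pose s := x :: enum (P :\ x)%SET.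
have szs : size s = p.+1 by rewrite /= -cardE; have := cardsD1 x P; rewrite xP cP; lia.
have us : uniq s by rewrite /= mem_enum !inE eqxx enum_uniq.
exists (fun a => nth x s a); split=> //.
- by move=> a b /eqP; rewrite nth_uniq ?szs // => /eqP/val_inj.
move=> y; have -> : (y \in P) = (y \in s).
  by rewrite inE mem_enum !inE; case: (eqVneq y x) => [->|//].
split=> [ys|[a <-]]; last by rewrite mem_nth // szs.
have ylt : (index y s < p.+1)%N by rewrite -szs index_mem.
by exists (Ordinal ylt); rewrite /= nth_index.
Qed.

Lemma sum_support (F : fieldType) n q (g : 'I_q -> 'I_n) (h : 'I_n -> F) :
  injective g -> (forall j, ~ (exists b, g b = j) -> h j = 0) ->
  \sum_j h j = \sum_b h (g b).
Proof.
move=> gi h0; rewrite (bigID (mem (g @: finset.setT))) /= addrC big1 ?add0r.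
  rewrite big_imset /=; last by move=> b b' _ _; apply: gi.
  by apply: eq_bigl => b; rewrite inE.
move=> j /imsetP nj; apply: h0 => -[b gb]; apply: nj; by exists b.
Qed.

Section ComponentCount.
Variables (F : numClosedFieldType) (m n : nat) (P : {set 'I_m}) (Q : {set 'I_n}).

(** The equations of [rank1_critical], tested only against tangent directions
    supported on P x Q. *)
Definition component_critical (U X : 'M[F]_(m, n)) :=
  [/\ supp_rank1 P Q X, X != 0,
      forall i k, i \in P -> ((U - X) *m X^T) i k = 0 &
      forall k j, j \in Q -> (X^T *m (U - X)) k j = 0].

Section Reindex.
Variables (p q : nat) (f : 'I_p -> 'I_m) (g : 'I_q -> 'I_n).
Hypotheses (fi : injective f) (gi : injective g).
Hypotheses (fP : forall i, i \in P <-> exists a, f a = i).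
Hypotheses (gQ : forall j, j \in Q <-> exists b, g b = j).

Definition extend (Y : 'M[F]_(p, q)) : 'M[F]_(m, n) :=
  \matrix_(i, j) \sum_a \sum_b (f a == i)%:R * (g b == j)%:R * Y a b.

Lemma extendE Y a b : extend Y (f a) (g b) = Y a b.
Proof.
rewrite mxE (bigD1 a) //= (bigD1 b) //= !eqxx !mul1r !big1 ?addr0 //.
  by move=> a' aa; apply: big1 => b' _; rewrite (inj_eq fi) (negPf aa) !mul0r.
by move=> b' bb; rewrite (inj_eq gi) (negPf bb) mulr0 mul0r.
Qed.

Lemma extend0 Y i j : ~~ ((i \in P) && (j \in Q)) -> extend Y i j = 0.
Proof.
rewrite negb_and mxE => /orP[iP|jQ]; apply: big1 => a _; apply: big1 => b _.
  have -> : (f a == i) = false.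
    by apply: contraNF iP => /eqP <-; apply/fP; exists a.
  by rewrite !mul0r.
have -> : (g b == j) = false.
  by apply: contraNF jQ => /eqP <-; apply/gQ; exists b.
by rewrite mulr0 mul0r.
Qed.

Lemma mxsub_extend Y : mxsub f g (extend Y) = Y.
Proof. by apply/matrixP => a b; rewrite mxE extendE. Qed.

Lemma extend_mxsub (X : 'M[F]_(m, n)) : supp_rank1 P Q X -> extend (mxsub f g X) = X.
Proof.
move=> [_ supp]; apply/matrixP => i j.
have [/andP[/fP[a <-] /gQ[b <-]]|ij] := boolP ((i \in P) && (j \in Q)).
  by rewrite extendE mxE.
by rewrite extend0 // supp.
Qed.

Lemma rank_mxsub (X : 'M[F]_(m, n)) : (\rank X <= 1)%N -> (\rank (mxsub f g X) <= 1)%N.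
Proof.
by move=> /rank_le1_minors r; apply/rank_le1_minors => i j k l; rewrite !mxE r.
Qed.

Lemma rank_extend Y : (\rank Y <= 1)%N -> (\rank (extend Y) <= 1)%N.
Proof.
move=> /rank_le1_minors r; apply/rank_le1_minors => i j k l.
have [iP|iP] := boolP (i \in P); last by rewrite !(extend0 Y (i := i)) ?(negPf iP) ?mul0r.
have [kP|kP] := boolP (k \in P); last by rewrite !(extend0 Y (i := k)) ?(negPf kP) ?mulr0.
have [jQ|jQ] := boolP (j \in Q); last first.
  by rewrite !(extend0 Y (j := j)) ?(negPf jQ) ?andbF ?mulr0 ?mul0r.
have [lQ|lQ] := boolP (l \in Q); last first.
  by rewrite !(extend0 Y (j := l)) ?(negPf lQ) ?andbF ?mulr0 ?mul0r.
move/fP: iP => [a <-]; move/fP: kP => [c <-]; move/gQ: jQ => [b <-]; move/gQ: lQ => [d <-].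
by rewrite !extendE r.
Qed.

Lemma component_critical_extend U Y :
  component_critical U (extend Y) <-> rank1_critical (mxsub f g U) Y.
Proof.
have nP i : i \notin P -> forall j, extend Y i j = 0.
  by move=> iP j; rewrite extend0 // (negPf iP).
have nQ j : j \notin Q -> forall i, extend Y i j = 0.
  by move=> jQ i; rewrite extend0 // (negPf jQ) andbF.
have e1 a c : ((U - extend Y) *m (extend Y)^T) (f a) (f c) =
              ((mxsub f g U - Y) *m Y^T) a c.
  rewrite !mxE (sum_support gi).
    by apply: eq_bigr => b _; rewrite [(extend Y)^T _ _]mxE
      [(U - _) _ _]mxE [(- extend Y) _ _]mxE !extendE !mxE.
  move=> j nj; have jQ : j \notin Q by apply/negP => /gQ.
  by rewrite [(extend Y)^T _ _]mxE nQ // mulr0.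
have e2 b d : ((extend Y)^T *m (U - extend Y)) (g b) (g d) =
              (Y^T *m (mxsub f g U - Y)) b d.
  rewrite !mxE (sum_support fi).
    by apply: eq_bigr => a _; rewrite [(extend Y)^T _ _]mxE
      [(U - _) _ _]mxE [(- extend Y) _ _]mxE !extendE !mxE.
  move=> i ni; have iP : i \notin P by apply/negP => /fP.
  by rewrite [(extend Y)^T _ _]mxE nP // mul0r.
split.
  move=> [CX X0 h1 h2]; split.
  - by rewrite -[Y]mxsub_extend; apply: rank_mxsub CX.1.
  - by apply: contraNneq X0 => ->; apply/eqP/matrixP => i j; rewrite !mxE big1 // => a _;
      apply: big1 => b _; rewrite mxE mulr0.
  - by apply/matrixP => a c; rewrite -e1 h1 ?mxE //; apply/fP; exists a.
  by apply/matrixP => b d; rewrite -e2 h2 ?mxE //; apply/gQ; exists d.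
move=> [r Y0 h1 h2]; split.
- by split; [apply: rank_extend | apply: extend0].
- by apply: contraNneq Y0 => e; rewrite -[Y]mxsub_extend e; apply/eqP/matrixP => i j; rewrite !mxE.
- move=> _ k /fP[a <-]; have [/fP[c <-]|kP] := boolP (k \in P); first by rewrite e1 h1 mxE.
  by rewrite mxE big1 // => j _; rewrite [(extend Y)^T _ _]mxE nP // mulr0.
move=> k _ /gQ[d <-]; have [/gQ[b <-]|kQ] := boolP (k \in Q); first by rewrite e2 h2 mxE.
by rewrite mxE big1 // => i _; rewrite [(extend Y)^T _ _]mxE nQ // mul0r.
Qed.

End Reindex.

Lemma generic_component_critical i0 j0 : i0 \in P -> j0 \in Q ->
  generic (fun U : 'M[F]_(m, n) => exists s : seq 'M[F]_(m, n),
    [/\ uniq s, size s = minn #|P| #|Q|, forall X, X \in s <-> component_critical U X &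
      forall X, X \in s -> X i0 j0 != 0]).
Proof.
move=> i0P j0Q.
case cP: #|P| => [|p]; first by move: i0P; rewrite (cards0_eq cP) inE.
case cQ: #|Q| => [|q]; first by move: j0Q; rewrite (cards0_eq cQ) inE.
have [f [fi f0 fP]] := enum_from i0P cP.
have [g [gi g0 gQ]] := enum_from j0Q cQ.
have := generic_rank1_critical F p q.
move=> /(@generic_comp _ m n _ _ _ (mxsub f g)) h; apply: generic_weaken (h _ _).
- move=> U [s [us ss hs s0]]; exists (map (extend f g) s); split.
  + by rewrite map_inj_uniq //; apply: (can_inj (mxsub_extend fi gi)).
  + by rewrite size_map.
  + move=> X; split=> [/mapP[Y /hs cY ->]|cX].
      exact/(component_critical_extend fi gi fP gQ).
    have XE := extend_mxsub fi gi fP gQ (let: And4 h _ _ _ := cX in h).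
    apply/mapP; exists (mxsub f g X); last by rewrite XE.
    by apply/hs/(component_critical_extend fi gi fP gQ); rewrite XE.
  by move=> _ /mapP[Y /s0 Y0 ->]; rewrite -f0 -g0 extendE.
- by move=> a b; apply: (polyfun_ext _ (polyfun_entry F (f a) (g b))) => X; rewrite mxE.
by move=> W; exists (extend f g W); rewrite mxsub_extend.
Qed.

End ComponentCount.

(** * Gluing the two components *)

Section Orthogonality.
Variables (F : numClosedFieldType) (m n : nat).

Lemma trace_mul_tr (A B : 'M[F]_(m, n)) : \tr (A *m B^T) = \sum_i \sum_j A i j * B i j.
Proof.
rewrite /mxtrace; apply: eq_bigr => i _; rewrite mxE; apply: eq_bigr => j _.
by rewrite mxE.
Qed.

Variables (P : {set 'I_m}) (Q : {set 'I_n}).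
Implicit Types U X A : 'M[F]_(m, n).

(** The lines t |-> (1 + t E) X and t |-> X (1 + t E), for elementary matrices E
    compatible with the support, stay on the component; their directions give
    the equations one entry at a time. *)
Lemma orthogonal_component_critical V U X :
  (supp_rank1 P Q `<=` V)%classic -> supp_rank1 P Q X -> X != 0 ->
  (forall A, tangent_space V X A -> \tr ((U - X) *m A^T) = 0) ->
  component_critical P Q U X.
Proof.
move=> CV CX X0 orth.
have deltaX i k a b : (delta_mx i k *m X) a b = (a == i)%:R * X k b.
  rewrite mxE (bigD1 k) //= mxE eqxx andbT big1 ?addr0 // => j /negPf jk.
  by rewrite mxE jk andbF mul0r.
have Xdelta k j a b : (X *m delta_mx k j) a b = X a k * (b == j)%:R.
  rewrite mxE (bigD1 k) //= mxE eqxx /= big1 ?addr0 // => l /negPf lk.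
  by rewrite mxE lk mulr0.
split=> // [i k iP|k j jQ].
  have -> : ((U - X) *m X^T) i k = \tr ((U - X) *m (delta_mx i k *m X)^T).
    rewrite trace_mul_tr (bigD1 i) //= [Y in _ = _ + Y]big1 ?addr0 => [|a /negPf ai].
      by rewrite mxE; apply: eq_bigr => b _; rewrite [X^T _ _]mxE deltaX eqxx mul1r.
    by rewrite big1 // => b _; rewrite deltaX ai mul0r mulr0.
  apply/orth/tangent_line => t; apply: CV; split.
    have -> : X + t *: (delta_mx i k *m X) = (1%:M + t *: delta_mx i k) *m X.
      by rewrite mulmxDl mul1mx scalemxAl.
    exact: leq_trans (mxrankM_maxr _ _) CX.1.
  move=> a b ab; rewrite mxE CX.2 // add0r mxE deltaX.
  case: (eqVneq a i) ab => [->|_ _]; last by rewrite mul0r mulr0.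
  by rewrite iP /= => bQ; rewrite CX.2 ?mulr0 // (negPf bQ) andbF.
have -> : (X^T *m (U - X)) k j = \tr ((U - X) *m (X *m delta_mx k j)^T).
  rewrite trace_mul_tr mxE; apply: eq_bigr => a _.
  rewrite (bigD1 j) //= [Y in _ = _ + Y]big1 ?addr0 => [|b /negPf bj].
    by rewrite Xdelta eqxx mulr1 [X^T _ _]mxE mulrC.
  by rewrite Xdelta bj !mulr0.
apply/orth/tangent_line => t; apply: CV; split.
  have -> : X + t *: (X *m delta_mx k j) = X *m (1%:M + t *: delta_mx k j).
    by rewrite mulmxDr mulmx1 scalemxAr.
  exact: leq_trans (mxrankM_maxl _ _) CX.1.
move=> a b ab; rewrite mxE CX.2 // add0r mxE Xdelta.
case: (eqVneq b j) ab => [->|_ _]; last by rewrite !mulr0.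
by rewrite jQ andbT => aP; rewrite CX.2 ?mul0r ?mulr0 // (negPf aP).
Qed.

Lemma component_critical_orthogonal U X i1 l A :
  component_critical P Q U X -> X i1 l != 0 -> tangent_eqs P Q i1 l X A ->
  \tr ((U - X) *m A^T) = 0.
Proof.
move=> [CX _ hr hc] X1 [supp eqs]; rewrite trace_mul_tr.
pose D := U - X; rewrite -/D in hr hc *.
have hr' i k : i \in P -> \sum_j D i j * X k j = 0.
  by move=> iP; rewrite -[RHS](hr i k iP) mxE; apply: eq_bigr => j _; rewrite [X^T _ _]mxE.
have hc' k j : j \in Q -> \sum_i D i j * X i k = 0.
  move=> jQ; rewrite -[RHS](hc k j jQ) mxE; apply: eq_bigr => i _.
  by rewrite [X^T _ _]mxE mulrC.
apply: (mulIf X1); rewrite mul0r mulr_suml.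
transitivity (\sum_i A i l * (\sum_j D i j * X i1 j)
   + \sum_j A i1 j * (\sum_i D i j * X i l) - A i1 l * \sum_i \sum_j D i j * X i j).
  have -> : \sum_j A i1 j * (\sum_i D i j * X i l) =
            \sum_i \sum_j A i1 j * (D i j * X i l).
    rewrite [RHS]exchange_big /=; apply: eq_bigr => j _; exact: mulr_sumr.
  rewrite mulr_sumr -sumrN -!big_split; apply: eq_bigr => i _ /=.
  rewrite !mulr_sumr mulr_suml -sumrN -!big_split; apply: eq_bigr => j _ /=.
  rewrite -mulrA; have -> : A i j * X i1 l = A i l * X i1 j + X i l * A i1 j - X i j * A i1 l.
    by rewrite -eqs addrK.
  ring.
rewrite !big1 ?mulr0 ?addr0 ?subr0 //.
- move=> i _; have [iP|iP] := boolP (i \in P); first exact: hr'.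
  by apply: big1 => j _; rewrite CX.2 ?mulr0 // (negPf iP).
- move=> j _; have [jQ|jQ] := boolP (j \in Q); first by rewrite hc' ?mulr0.
  by rewrite supp ?mul0r // (negPf jQ) andbF.
move=> i _; have [iP|iP] := boolP (i \in P); first by rewrite hr' ?mulr0.
by rewrite supp ?mul0r // (negPf iP).
Qed.

End Orthogonality.

Section EmptyComponent.
Variables (F : numClosedFieldType) (m n : nat) (P : {set 'I_m}) (Q : {set 'I_n}).

Lemma generic_all (T : 'M[F]_(m, n) -> Prop) : (forall U, T U) -> generic T.
Proof.
move=> h; exists (fun=> 1); split=> //; first exact: polyfun_cst.
by exists 0; rewrite oner_eq0.
Qed.

Lemma supp_rank1_empty (X : 'M[F]_(m, n)) : (#|P| == 0)%N || (#|Q| == 0)%N ->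
  supp_rank1 P Q X -> X = 0.
Proof.
move=> h [_ supp]; apply/matrixP => i j; rewrite mxE supp //.
by case/orP: h => /eqP/cards0_eq ->; rewrite inE ?andbF.
Qed.

Lemma generic_component_critical_col j0 : j0 \in Q ->
  generic (fun U : 'M[F]_(m, n) => exists s : seq 'M[F]_(m, n),
    [/\ uniq s, size s = minn #|P| #|Q|, forall X, X \in s <-> component_critical P Q U X &
      forall X, X \in s -> exists i, X i j0 != 0]).
Proof.
move=> j0Q; have [P0|[i0 i0P]] := set_0Vmem P.
  apply: generic_all => U; exists [::]; split=> //; first by rewrite P0 cards0 min0n.
  move=> X; split=> // -[CX X0 _ _]; case/eqP: X0.
  by apply: supp_rank1_empty CX; rewrite P0 cards0.
apply: generic_weaken (generic_component_critical F i0P j0Q) => U [s [us ss hs s0]].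
by exists s; split=> // X /s0; exists i0.
Qed.

Lemma generic_component_critical_row i0 : i0 \in P ->
  generic (fun U : 'M[F]_(m, n) => exists s : seq 'M[F]_(m, n),
    [/\ uniq s, size s = minn #|P| #|Q|, forall X, X \in s <-> component_critical P Q U X &
      forall X, X \in s -> exists j, X i0 j != 0]).
Proof.
move=> i0P; have [Q0|[j0 j0Q]] := set_0Vmem Q.
  apply: generic_all => U; exists [::]; split=> //; first by rewrite Q0 cards0 minn0.
  move=> X; split=> // -[CX X0 _ _]; case/eqP: X0.
  by apply: supp_rank1_empty CX; rewrite Q0 cards0 orbT.
apply: generic_weaken (generic_component_critical F i0P j0Q) => U [s [us ss hs s0]].
by exists s; split=> // X /s0; exists j0.
Qed.

End EmptyComponent.

Section Block.
Variables (F : numClosedFieldType) (m n : nat) (S : {set 'I_m * 'I_n}).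
Variables (I0 : {set 'I_m}) (J0 : {set 'I_n}) (i0 : 'I_m) (j0 : 'I_n) (a0 : 'I_m) (b0 : 'I_n).
Hypotheses (SE : forall i j, ((i, j) \in S) = (i \in I0) && (j \in J0)).
Hypotheses (i0I : i0 \in I0) (j0J : j0 \in J0) (abS : (a0, b0) \notin S).

Local Notation V := (@sparse_rank_le1 F m n S).
Local Notation A := (@supp_rank1 F m n (~: I0)%SET [set: 'I_n]%SET).
Local Notation B := (@supp_rank1 F m n [set: 'I_m]%SET (~: J0)%SET).

Lemma sub_rows : (A `<=` V)%classic.
Proof.
move=> X [r supp]; split=> // i j; rewrite SE => /andP[iI jJ].
by apply: supp; rewrite !inE iI.
Qed.

Lemma sub_cols : (B `<=` V)%classic.
Proof.
move=> X [r supp]; split=> // i j; rewrite SE => /andP[iI jJ].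
by apply: supp; rewrite !inE jJ.
Qed.

Lemma block_decomposition : (V `<=` A `|` B)%classic.
Proof.
move=> X [r sparse]; have minors := (rank_le1_minors X).1 r.
apply: contrapT => /not_orP[nA nB].
have [i [j [iI ij]]] : exists i j, i \in I0 /\ X i j != 0.
  apply: contrapT => h; apply: nA; split=> // i j; rewrite !inE andbT negbK => iI.
  by apply: contrapT => /eqP hij; apply: h; exists i, j.
have [k [l [lJ kl]]] : exists k l, l \in J0 /\ X k l != 0.
  apply: contrapT => h; apply: nB; split=> // k l; rewrite !inE negbK => lJ.
  by apply: contrapT => /eqP hij; apply: h; exists k, l.
have := minors i j k l; rewrite (sparse i l) ?SE ?iI ?lJ // mul0r => /eqP.
by rewrite mulf_eq0 (negPf ij) (negPf kl).
Qed.

(** A nonzero entry in a column of [J0] keeps [X] off the other component. The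
    entries of a tangent vector in the rows of [I0] vanish: in the columns of
    [J0] by the pattern, and elsewhere by the minor through that entry. *)
Lemma row_component_ED_critical (U X : 'M[F]_(m, n)) i1 :
  component_critical (~: I0)%SET [set: 'I_n]%SET U X ->
  X i1 j0 != 0 -> ED_critical V U X.
Proof.
move=> cX X1; have [CX X0 _ _] := cX.
have Vrank Y : V Y -> (\rank Y <= 1)%N by case.
have nB : ~ B X by move=> [_ supp]; case/eqP: X1; apply: supp; rewrite !inE j0J.
have Vsupp T : tangent_space V X T ->
    forall i j, ~~ ((i \in ~: I0)%SET && (j \in [set: 'I_n])%SET) -> T i j = 0.
  move=> tT i j; rewrite !inE andbT negbK => iI.
  have Xi k : X i k = 0 by apply: CX.2; rewrite !inE iI.
  have Tij0 : T i j0 = 0.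
    by apply: (tangent_entry0 _ tT) => Y [_]; apply; rewrite SE iI j0J.
  have := tangent_minor i j i1 j0 Vrank tT; rewrite !Xi Tij0 !mul0r !addr0 => /eqP.
  by rewrite mulf_eq0 (negPf X1) orbF => /eqP.
split.
  exact: (smooth_component CX X1 sub_rows block_decomposition
    (zariski_closed_supp_rank1 F _ _) nB Vrank Vsupp).
move=> T /(tangent_spaceE CX X1 sub_rows Vrank Vsupp).
exact: component_critical_orthogonal cX X1.
Qed.

Lemma col_component_ED_critical (U X : 'M[F]_(m, n)) l :
  component_critical [set: 'I_m]%SET (~: J0)%SET U X ->
  X i0 l != 0 -> ED_critical V U X.
Proof.
move=> cX X1; have [CX X0 _ _] := cX.
have Vrank Y : V Y -> (\rank Y <= 1)%N by case.
have nA : ~ A X by move=> [_ supp]; case/eqP: X1; apply: supp; rewrite !inE i0I.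
have Vsupp T : tangent_space V X T ->
    forall i j, ~~ ((i \in [set: 'I_m])%SET && (j \in ~: J0)%SET) -> T i j = 0.
  move=> tT i j; rewrite !inE negbK => jJ.
  have Xj k : X k j = 0 by apply: CX.2; rewrite !inE jJ.
  have Tij0 : T i0 j = 0.
    by apply: (tangent_entry0 _ tT) => Y [_]; apply; rewrite SE jJ i0I.
  have := tangent_minor i j i0 l Vrank tT.
  rewrite !Xj Tij0 !mul0r !mulr0 !addr0 => /eqP.
  by rewrite mulf_eq0 (negPf X1) orbF => /eqP.
have dec : (V `<=` B `|` A)%classic by move=> Y /block_decomposition[]; [right|left].
split.
  exact: (smooth_component CX X1 sub_cols dec
    (zariski_closed_supp_rank1 F _ _) nA Vrank Vsupp).
move=> T /(tangent_spaceE CX X1 sub_cols Vrank Vsupp).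
exact: component_critical_orthogonal cX X1.
Qed.

(** The line spanned by the elementary matrix at [(a0, b0)] lies on the variety, so
    criticality of 0 would force [U a0 b0 = 0]. *)
Lemma ED_critical_neq0 (U X : 'M[F]_(m, n)) : U a0 b0 != 0 -> ED_critical V U X -> X != 0.
Proof.
move=> U0 [[VX _] orth]; apply: contraNneq U0 => X0.
have tE : tangent_space V X (delta_mx a0 b0).
  apply: tangent_line => t; rewrite X0 add0r; split.
    by apply: leq_trans (mxrank_scale _ _) _; rewrite mxrank_delta.
  move=> i j ijS; rewrite !mxE; case: eqP => [ei|]; last by rewrite mulr0.
  case: eqP => [ej|]; last by rewrite mulr0.
  by move: abS; rewrite -ei -ej ijS.
have := orth _ tE; rewrite trace_mul_tr X0 subr0.
rewrite (bigD1 a0) //= (bigD1 b0) //= mxE !eqxx mulr1 !big1 ?addr0.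
- by move=> ->.
- by move=> i /negPf ia; apply: big1 => j _; rewrite mxE ia mulr0.
by move=> j /negPf jb; rewrite mxE jb andbF mulr0.
Qed.

(** The lists of critical points of the two components, put together. *)
Lemma EDdegree_block : EDdegree_is V (minn #|(~: I0)%SET| n + minn m #|(~: J0)%SET|).
Proof.
have gA := @generic_component_critical_col F m n (~: I0)%SET [set: 'I_n]%SET j0 (finset.in_setT _).
have gB := @generic_component_critical_row F m n [set: 'I_m]%SET (~: J0)%SET i0 (finset.in_setT _).
have g0 : generic (fun U : 'M[F]_(m, n) => U a0 b0 != 0).
  exists (fun U => U a0 b0); split=> //; first exact: polyfun_entry.
  by exists (delta_mx a0 b0); rewrite mxE !eqxx oner_eq0.
have [f [pf [U0 fU0] hf]] := generic_and g0 (generic_and gA gB).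
exists (fun U => forall _ : unit, f U = 0); split.
- exact: zariski_closed_polyfun.
- by exists U0 => /(_ tt)/eqP; apply/negP.
move=> U nU; have fU : f U != 0 by apply/eqP => e; apply: nU.
have [Uab [[sA [uA szA hA nzA]] [sB [uB szB hB nzB]]]] := hf U fU.
exists (sA ++ sB); split.
- rewrite cat_uniq uA uB andbT /=; apply/hasPn => X /hB[[_ suppB] _ _ _].
  apply/negP => XA; have [i /eqP] := nzA X XA; apply; apply: suppB.
  by rewrite !inE j0J.
- by rewrite size_cat szA szB !cardsT !card_ord.
move=> X; rewrite mem_cat; split=> [/orP[XA|XB]|cX].
- by have [i Xi] := nzA X XA; apply: row_component_ED_critical Xi; apply/hA.
- by have [j Xj] := nzB X XB; apply: col_component_ED_critical Xj; apply/hB.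
have X0 := ED_critical_neq0 Uab cX; have [[VX _] orth] := cX.
have [AX|BX] := block_decomposition VX.
  by apply/orP; left; apply/hA/(orthogonal_component_critical sub_rows).
by apply/orP; right; apply/hB/(orthogonal_component_critical sub_cols).
Qed.

End Block.

Lemma perm_equivalentP m n (S T : {set 'I_m * 'I_n}) : perm_equivalent S T ->
  exists (s : {perm 'I_m}) (t : {perm 'I_n}),
    forall i j, ((i, j) \in S) = ((s i, t j) \in T).
Proof.
move=> [P1 [P2 [/is_perm_mxP[s ->] /is_perm_mxP[t ->] e]]]; exists s, (t^-1)%g => i j.
move/matrixP/(_ i j): e; rewrite -row_permE -{1}[t]invgK -col_permE !mxE.
by case: (_ \in S); case: (_ \in T).
Qed.

Theorem corollary3p8 (R : realType) (m n : nat) (S : {set 'I_m * 'I_n})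
    (S_nonempty : (0 < #|S|)%N) (S_proper : (#|S| < m * n)%N) :
  (perm_equivalent S (row_zero_pattern m n #|S|) ->
     EDdegree_is (@sparse_rank_le1 R[i]%C m n S)
       (minn m (n - #|S|) + minn (m - 1) n)%N)
  /\
  (perm_equivalent S (column_zero_pattern m n #|S|) ->
     EDdegree_is (@sparse_rank_le1 R[i]%C m n S)
       (minn m (n - 1) + minn (m - #|S|) n)%N).
Proof.
have /card_gt0P[[i0 j0] ijS] := S_nonempty.
have [[a0 b0] abS] : exists ab, ab \notin S.
  apply: contrapT => h; move: S_proper; rewrite ltnNge; case/negP.
  have -> : (m * n)%N = #|{: 'I_m * 'I_n}| by rewrite card_prod !card_ord.
  apply: subset_leq_card; apply/fintype.subsetP => ab _; apply: contrapT => /negP nab.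
  by apply: h; exists ab.
(* A nonempty S meets row (or column) 0 of the pattern, so that I0 (or J0) is
   a singleton and the other side of the block has #|S| elements. *)
have card1 k (s : {perm 'I_k}) i : s i = 0%N :> nat -> #|[set j | s j == 0%N :> nat]%SET| = 1%N.
  move=> si; apply/eqP/cards1P; exists i; apply/setP => j; rewrite !inE.
  by rewrite -si val_eqE (inj_eq perm_inj).
split=> /perm_equivalentP[s [t SE]].
  pose I0 := [set i | s i == 0%N :> nat]%SET; pose J0 := [set j | (t j < #|S|)%N]%SET.
  have SE' i j : ((i, j) \in S) = (i \in I0) && (j \in J0) by rewrite SE !inE.
  have /andP[i0I j0J] : (i0 \in I0) && (j0 \in J0) by rewrite -SE'.
  have SX : S = finset.setX I0 J0 by apply/setP => -[i j]; rewrite SE' [RHS]inE.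
  have cI : #|I0| = 1%N by apply: (card1 _ _ i0); move: i0I; rewrite inE => /eqP.
  have cJ : #|J0| = #|S| by rewrite [in RHS]SX cardsX cI mul1n.
  have := @EDdegree_block R[i]%C m n S I0 J0 i0 j0 a0 b0 SE' i0I j0J abS.
  by rewrite [#|(~: I0)%SET|]cardsCs [#|(~: J0)%SET|]cardsCs !finset.setCK !card_ord cI cJ addnC.
pose I0 := [set i | (s i < #|S|)%N]%SET; pose J0 := [set j | t j == 0%N :> nat]%SET.
have SE' i j : ((i, j) \in S) = (i \in I0) && (j \in J0) by rewrite SE !inE.
have /andP[i0I j0J] : (i0 \in I0) && (j0 \in J0) by rewrite -SE'.
have SX : S = finset.setX I0 J0 by apply/setP => -[i j]; rewrite SE' [RHS]inE.
have cJ : #|J0| = 1%N by apply: (card1 _ _ j0); move: j0J; rewrite inE => /eqP.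
have cI : #|I0| = #|S| by rewrite [in RHS]SX cardsX cJ muln1.
have := @EDdegree_block R[i]%C m n S I0 J0 i0 j0 a0 b0 SE' i0I j0J abS.
by rewrite [#|(~: I0)%SET|]cardsCs [#|(~: J0)%SET|]cardsCs !finset.setCK !card_ord cI cJ addnC.
Qed.
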